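(* Let $\ell$ be any nonnegative integer or $\ell=\infty$, and let $f\in L^2(\Omega)$, $F(v):=\int_\Omega f v\,dx$. A function $u_H^{(\ell)}\in V_H$ satisfies $$a\big(u_H^{(\ell)},(1-\mathcal C^{(\ell)})v_H\big)=F(v_H)\quad\text{for all }v_H\in V_H$$ if and only if it satisfies $$\mathfrak a^{(\ell)}\big(u_H^{(\ell)},v_H\big)=F(v_H)\quad\text{for all }v_H\in V_H .$$ Here $\mathcal C^{(\ell)}$ is the localized corrector operator and $\mathfrak a^{(\ell)}$ is the bilinear form with the nonlocal piecewise constant kernel $\mathcal A_H^{(\ell)}$, both defined in the context.
   Context: Let $\Omega\subseteq\mathbb R^d$, $d\in\{1,2,3\}$, be an open Lipschitz polytope. $A\in L^\infty(\Omega;\mathbb R^{d\times d})$ is symmetric with $\alpha|\xi|^2\le\xi\cdot(A(x)\xi)\le\beta|\xi|^2$ for all $\xi\in\mathbb R^d$ and a.e. $x\in\Omega$, where $0<\alpha\le\beta<\infty$. $V:=H^1_0(\Omega)$, $a(v,w):=\int_\Omega\nabla w\cdot(A\nabla v)\,dx$. Mesh: $\mathcal T_H$ is a regular (conforming) simplicial triangulation of $\Omega$ from a quasi-uniform family, $H:=\max_{T\in\mathcal T_H}\operatorname{diam}T$. $V_H\subseteq V$ is the space of continuous $\mathcal T_H$-piecewise affine functions in $V$. For $S\subseteq\overline\Omega$, $\mathsf N(S):=\operatorname{int}\big(\bigcup\{T\in\mathcal T_H: T\cap\overline S\ne\emptyset\}\big)$, $\mathsf N^1:=\mathsf N$, $\mathsf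 N^m(S):=\mathsf N(\mathsf N^{m-1}(S))$ for $m\ge2$; $\mathsf N^0(T):=\operatorname{int}T$. Quasi-interpolation: $I_H:V\to V_H$ is a surjective linear projection ($I_H\circ I_H=I_H$) such that for all $T\in\mathcal T_H$, $v\in V$: $H^{-1}\|v-I_Hv\|_{L^2(T)}+\|\nabla I_Hv\|_{L^2(T)}\le C_{I_H}\|\nabla v\|_{L^2(\mathsf N(T))}$ and $\|I_Hv\|_{L^2(T)}\le C_{I_H}\|v\|_{L^2(\mathsf N(T))}$. $W:=\ker I_H\subseteq V$. Correctors: for $T\in\mathcal T_H$ let $\Omega_T:=\mathsf N^\ell(T)$ ($\Omega_T:=\Omega$ if $\ell=\infty$) and $W_{\Omega_T}:=\{w\in W: w=0\text{ outside }\Omega_T\}$. For $j=1,\dots,d$ let $q_{T,j}^{(\ell)}\in W_{\Omega_T}$ be the unique solution of $$\int_{\Omega_T}\nabla w\cdot(A\nabla q^{(\ell)}_{T,j})\,dx=\int_T\nabla w\cdot(Ae_j)\,dx\quad\text{for all }w\in W_{\Omega_T},$$ with $e_j$ the $j$-th unit vector. For $v_H\in V_H$ put $\mathcal C^{(\ell)}v_H:=\sum_{T\in\mathcal T_H}\sum_{j=1}^d(\partial_jv_H|_T)\,q^{(\ell)}_{T,j}$. Kernel: for $T,K\in\mathcal T_H$, $(\mathcal K^{(\ell)}_{T,K})_{j,k}:=\frac1{|T||K|}\,e_j\cdot\int_KA\nabla q^{(\ell)}_{T,k}\,dx$ and $\mathcal A_H^{(\ell)}|_{T,K}:=\frac{\delta_{T,K}}{|K|}\,|T|^{-1}\int_TA\,dx-\mathcal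 K^{(\ell)}_{T,K}$ ($\delta$ the Kronecker symbol). Write $\mathcal A_H^{(\ell)}(x,y):=\mathcal A_H^{(\ell)}|_{T,K}$ for $x\in T$, $y\in K$. The bilinear form on $V_H\times V_H$ is $$\mathfrak a^{(\ell)}(v_H,z_H):=\int_\Omega\int_\Omega\nabla v_H(y)\cdot\big(\mathcal A^{(\ell)}_H(x,y)\nabla z_H(x)\big)\,dy\,dx .$$ *)

(* Defs.v *)
From HB Require Import structures.
From mathcomp Require Import all_boot all_order all_algebra.
From mathcomp Require Import all_classical all_reals all_analysis.

Set Implicit Arguments.
Unset Strict Implicit.
Unset Printing Implicit Defensive.

Import Order.TTheory GRing.Theory Num.Theory.
Import numFieldNormedType.Exports.

Local Open Scope classical_set_scope.
Local Open Scope ring_scope.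

(* Points and vectors of R^d are column vectors 'cV[R]_d.  The sigma-algebra
   on 'cV[R]_d is the product of the Borel sigma-algebras of the coordinates
   (equivalently the Borel sigma-algebra of R^d). *)
Section cV_measurable.
Variables (R : realType) (n : nat).

Let coord (i : 'I_n) (x : 'cV[R]_n) : R := x i ord0.

Let cV_set0 : g_sigma_preimage coord set0.
Proof. exact: sigma_algebra0. Qed.

Let cV_setC A : g_sigma_preimage coord A -> g_sigma_preimage coord (~` A).
Proof. exact: sigma_algebraC. Qed.

Let cV_bigcup (F : (set 'cV[R]_n)^nat) :
  (forall i, g_sigma_preimage coord (F i)) ->
  g_sigma_preimage coord (\bigcup_i (F i)).
Proof. exact: sigma_algebra_bigcup. Qed.

HB.instance Definition _ := @isMeasurable.Build default_measure_display
  'cV[R]_n (g_sigma_preimage coord) cV_set0 cV_setC cV_bigcup.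

Lemma measurable_cV_coord (i : 'I_n) :
  measurable_fun [set: 'cV[R]_n] (fun x : 'cV[R]_n => x i ord0).
Proof.
move=> _ Y mY; rewrite setTI; apply: sub_sigma_algebra => /=.
rewrite -bigcup_seq/=; exists i => /=; first by rewrite mem_index_enum.
by exists Y => //; rewrite setTI.
Qed.

Lemma measurable_fun_cVP d (T : measurableType d) (f : T -> 'cV[R]_n) :
  (forall i, measurable_fun [set: T] (fun x => f x i ord0)) ->
  measurable_fun [set: T] f.
Proof.
move=> mf _ Y mY; rewrite setTI.
suff: g_sigma_preimage coord `<=` [set A | measurable (f @^-1` A)] by exact.
apply: smallest_sub; first split => /=.
- by rewrite preimage_set0.
- by move=> A mA; rewrite setTD preimage_setC; exact: measurableC.
- by move=> F mF; rewrite preimage_bigcup; exact: bigcup_measurable.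
rewrite -bigcup_seq => A [i _ [B mB <-]] /=.
by rewrite setTI -[X in measurable X]setTI; exact: mf.
Qed.

End cV_measurable.

(* Lebesgue measure on R^n, by recursion on n: Dirac mass on R^0, and the image
   of (lebesgue measure on R) x (Lebesgue measure on R^n) under the
   identification R x R^n = R^(n+1). *)
Section lebesgue_cV.
Variable R : realType.

Definition cV_cons n (p : R * 'cV[R]_n) : 'cV[R]_n.+1 :=
  \col_i (if unlift ord0 i is Some j then p.2 j ord0 else p.1).

Lemma cV_cons0 n p : @cV_cons n p ord0 ord0 = p.1.
Proof. by rewrite mxE unlift_none. Qed.

Lemma cV_consS n p i : @cV_cons n p (lift ord0 i) ord0 = p.2 i ord0.
Proof. by rewrite mxE liftK. Qed.

Lemma measurable_cV_cons n : measurable_fun [set: R * 'cV[R]_n] (@cV_cons n).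
Proof.
apply: measurable_fun_cVP => i; case: (unliftP ord0 i) => [j|] ->.
- under eq_fun do rewrite cV_consS.
  apply: (measurableT_comp (measurable_cV_coord j)); exact: measurable_snd.
- under eq_fun do rewrite cV_cons0.
  exact: measurable_fst.
Qed.

Section step.
Variables (n : nat) (mu : {sigma_finite_measure set 'cV[R]_n -> \bar R}).

Definition lebesgue_cV_step : set 'cV[R]_n.+1 -> \bar R :=
  pushforward (lebesgue_measure \x mu)%E (@cV_cons n).

Let step0 : lebesgue_cV_step set0 = 0%E.
Proof. by rewrite /lebesgue_cV_step /pushforward preimage_set0 measure0. Qed.

Let step_ge0 A : (0 <= lebesgue_cV_step A)%E.
Proof. by rewrite /lebesgue_cV_step /pushforward; exact: (measure_ge0 (lebesgue_measure \x mu)%E). Qed.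

Let step_sigma_additive : semi_sigma_additive lebesgue_cV_step.
Proof.
move=> F mF tF mUF; rewrite /lebesgue_cV_step /pushforward preimage_bigcup.
have mc (A : set 'cV[R]_n.+1) : measurable A -> measurable (@cV_cons n @^-1` A).
  by move=> mA; rewrite -[X in measurable X]setTI; exact: measurable_cV_cons.
apply: measure_semi_sigma_additive.
- by move=> k; exact: mc.
- apply/trivIsetP => /= i j _ _ ij; rewrite -preimage_setI.
  by move/trivIsetP : tF => /(_ _ _ _ _ ij) ->//; rewrite preimage_set0.
- by rewrite -preimage_bigcup; exact: mc.
Qed.

HB.instance Definition _ := isMeasure.Build _ _ _ lebesgue_cV_step
  step0 step_ge0 step_sigma_additive.

Let step_sigma_finite : sigma_finite setT lebesgue_cV_step.
Proof.
have [F TF Foo] := sigma_finiteT (@lebesgue_measure R).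
have [G TG Goo] := sigma_finiteT mu.
have mF k : measurable (F k) by have [] := Foo k.
have mG k : measurable (G k) by have [] := Goo k.
pose uncons (x : 'cV[R]_n.+1) : R * 'cV[R]_n :=
  (x ord0 ord0, \col_i x (lift ord0 i) ord0).
have consK p : uncons (@cV_cons n p) = p.
  case: p => a b; rewrite /uncons cV_cons0/=; congr pair.
  by apply/colP => i; rewrite mxE cV_consS.
have mu_uncons : measurable_fun [set: 'cV[R]_n.+1] uncons.
  apply/measurable_fun_pairP; split.
    exact: (measurable_cV_coord (ord0 : 'I_n.+1)).
  apply: measurable_fun_cVP => i; under eq_fun do rewrite /= mxE.
  exact: measurable_cV_coord.
pose D k := let: (i, j) := odflt (0%N, 0%N) (unpickle k) in F i `*` G j.
exists (fun k => uncons @^-1` D k).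
  apply/esym; rewrite -subTset => x _.
  have [i _ Fi] : (\bigcup_i F i) (uncons x).1 by rewrite -TF.
  have [j _ Gj] : (\bigcup_i G i) (uncons x).2 by rewrite -TG.
  by exists (pickle (i, j)) => //; rewrite /preimage/= /D pickleK.
move=> k; rewrite /D; case: (odflt _ _) => i j.
have mFG : measurable (F i `*` G j) by exact: measurableX.
split; first by rewrite -[X in measurable X]setTI; exact: mu_uncons.
rewrite /lebesgue_cV_step /pushforward.
rewrite (_ : _ @^-1` _ = F i `*` G j); last first.
  by apply/funext => p; rewrite /preimage /mkset consK.
have [_ Fi] := Foo i; have [_ Gj] := Goo j.
by rewrite product_measure1E// lte_mul_pinfty// ge0_fin_numE.
Qed.

HB.instance Definition _ :=
  @Measure_isSigmaFinite.Build _ _ _ lebesgue_cV_step step_sigma_finite.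

End step.

Fixpoint lebesgue_cV n : {sigma_finite_measure set 'cV[R]_n -> \bar R} :=
  if n is n'.+1 then lebesgue_cV_step (lebesgue_cV n')
  else \d_(0 : 'cV[R]_0).

End lebesgue_cV.

Section sobolev.
Variables (R : realType) (d : nat).
Notation E := 'cV[R]_d.
Notation leb := (lebesgue_cV R d).

Definition unitv (j : 'I_d) : E := delta_mx j ord0.

Definition dot (u v : E) : R := \sum_(i < d) u i ord0 * v i ord0.

(* The library norm on 'cV[R]_d is the max norm. *)
Definition enorm (u : E) : R := Num.sqrt (dot u u).

(* Scalar functions are total functions on R^d of which only the values on D
   matter; the L^p classes are these functions modulo [ae_eq leb D]. *)
Definition in_Lp (p : \bar R) (D : set E) (f : E -> R) : Prop :=
  measurable_fun D f /\ finite_norm leb p (f \_ D).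

Definition L2norm (D : set E) (f : E -> R) : R :=
  fine ('N[leb]_2%:E [EFin \o (f \_ D)]).

Definition L2normv (D : set E) (g : E -> E) : R := L2norm D (enorm \o g).

Definition vint (D : set E) (g : E -> E) : E :=
  \col_i \int[leb]_(x in D) (g x i ord0).

Definition mint (D : set E) (B : E -> 'M[R]_d) : 'M[R]_d :=
  \matrix_(i, j) \int[leb]_(x in D) (B x i j).

Definition vol (D : set E) : R := fine (leb D).

Definition partial (j : 'I_d) (f : E -> R) (x : E) : R := 'D_(unitv j) f x.

Fixpoint class_C (k : nat) (f : E -> R) : Prop :=
  continuous f /\
  if k is k'.+1 then
    forall j, (forall x, derivable f x (unitv j)) /\ class_C k' (partial j f)
  else True.

(* C_c^infty(Omega) *)
Definition test_function (Omega : set E) (phi : E -> R) : Prop :=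
  [/\ forall k, class_C k phi,
      compact (closure [set x | phi x != 0])
    & closure [set x | phi x != 0] `<=` Omega].

Definition weak_gradient (Omega : set E) (v : E -> R) (g : E -> E) : Prop :=
  (forall j, in_Lp 2%:E Omega (fun x => g x j ord0)) /\
  forall phi, test_function Omega phi -> forall j,
    \int[leb]_(x in Omega) (v x * partial j phi x) =
    - \int[leb]_(x in Omega) (g x j ord0 * phi x).

Definition grad (Omega : set E) (v : E -> R) : E -> E :=
  xget (fun=> 0) [set g | weak_gradient Omega v g].

Definition H1 (Omega : set E) : set (E -> R) :=
  [set v | in_Lp 2%:E Omega v /\ exists g, weak_gradient Omega v g].

Definition H1norm (Omega : set E) (v : E -> R) : R :=
  Num.sqrt (L2norm Omega v ^+ 2 + L2normv Omega (grad Omega v) ^+ 2).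

(* closure of C_c^infty(Omega) in H^1(Omega) *)
Definition H10 (Omega : set E) : set (E -> R) :=
  [set v | H1 Omega v /\
    forall eps : R, 0 < eps -> exists phi,
      test_function Omega phi /\ H1norm Omega (v \- phi) < eps].

End sobolev.

Section geometry.
Variables (R : realType) (d : nat).
Notation E := 'cV[R]_d.

Definition hull (S : set E) : set E :=
  [set x | exists (n : nat) (p : 'I_n -> E) (lam : 'I_n -> R),
     [/\ forall i, S (p i), forall i, 0 <= lam i, \sum_i lam i = 1
       & x = \sum_i lam i *: p i]].

(* Bounded open polyhedral set, not necessarily convex. *)
Definition open_polytope (Omega : set E) : Prop :=
  open Omega /\
  exists (m : nat) (S : 'I_m -> set E),
    (forall i, finite_set (S i)) /\ closure Omega = \bigcup_i hull (S i).

(* Near each boundary point z, Omega is the strict epigraph, in the direction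
   of a unit vector e, of a Lipschitz function gamma on the hyperplane
   orthogonal to e. *)
Definition lipschitz_boundary (Omega : set E) : Prop :=
  forall z, closure Omega z -> ~ Omega z ->
  exists (e : E) (gamma : E -> R) (L r : R),
    [/\ enorm e = 1, 0 < r,
        forall y y', dot y e = 0 -> dot y' e = 0 ->
          `|gamma y - gamma y'| <= L * enorm (y - y')
      & forall x, enorm (x - z) < r ->
          (Omega x <-> gamma (x - dot x e *: e) < dot x e)].

Definition diam (S : set E) : R :=
  sup [set enorm (x - y) | x in S & y in S].

(* A finite list of simplices given by their vertices. *)
Record mesh := Mesh {
  ncells : nat;
  vertex : 'I_ncells -> 'I_d.+1 -> E }.

Definition cell (M : mesh) (T : 'I_(ncells M)) : set E :=
  hull (range (vertex T)).

Definition meshsize (M : mesh) : R :=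
  \big[Num.max/0]_(T < ncells M) diam (cell T).

Definition regular_triangulation (Omega : set E) (M : mesh) : Prop :=
  [/\ forall T : 'I_(ncells M),
        \matrix_(i < d, j < d)
          (vertex T (lift ord0 j) - vertex T ord0) i ord0 \in unitmx,
      injective (@cell M),
      (* conformity: two cells meet in a common face (possibly empty) *)
      forall T K : 'I_(ncells M),
        cell T `&` cell K = hull (range (vertex T) `&` range (vertex K))
    & \bigcup_T @cell M T = closure Omega].

(* A family of meshes is quasi-uniform if one rho > 0 works for all members. *)
Definition quasi_uniform (rho : R) (M : mesh) : Prop :=
  forall T : 'I_(ncells M), exists z : E,
    [set x | enorm (x - z) <= rho * meshsize M] `<=` cell T.

Definition patch (M : mesh) (S : set E) : set E :=
  (\bigcup_(T in [set T | @cell M T `&` closure S !=set0]) @cell M T)°.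

(* N^l(T), with l = None standing for l = oo. *)
Definition layer (Omega : set E) (M : mesh) (l : option nat)
    (T : 'I_(ncells M)) : set E :=
  match l with
  | None => Omega
  | Some 0%N => (cell T)°
  | Some m => iter m (patch M) (cell T)
  end.

End geometry.

Section fem.
Variables (R : realType) (d : nat).
Notation E := 'cV[R]_d.
Notation leb := (lebesgue_cV R d).
Variables (Omega : set E) (A : E -> 'M[R]_d) (M : mesh R d).
Notation V := (H10 Omega).
Notation grad := (grad Omega).

Definition elliptic_coefficient (alpha beta : R) : Prop :=
  [/\ forall i j, in_Lp +oo%E Omega (fun x => A x i j),
      {ae leb, forall x, Omega x -> (A x)^T = A x}
    & {ae leb, forall x, Omega x -> forall xi : E,
        alpha * enorm xi ^+ 2 <= dot xi (A x *m xi) <= beta * enorm xi ^+ 2}].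

Definition aform (v w : E -> R) : R :=
  \int[leb]_(x in Omega) dot (grad w x) (A x *m grad v x).

Definition affine_on (S : set E) (v : E -> R) (b : E) : Prop :=
  exists c : R, forall x, S x -> v x = c + dot b x.

(* Elements of V_H are represented by their continuous representative on the
   closure of Omega. *)
Definition VH : set (E -> R) :=
  [set v | [/\ V v, {within closure Omega, continuous v}
             & forall T : 'I_(ncells M), exists b, affine_on (cell T) v b]].

(* The constant gradient of the affine function v|_T. *)
Definition cell_grad (v : E -> R) (T : 'I_(ncells M)) : E :=
  xget 0 [set b | affine_on (cell T) v b].

Record quasi_interpolation (IH : (E -> R) -> E -> R) (C : R) : Prop :=
  QuasiInterpolation {
  (* IH is a map V -> VH of classes modulo a.e. equality *)
  qi_range : forall v, V v -> VH (IH v);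
  qi_ae : forall v w, V v -> V w ->
    ae_eq leb Omega v w -> ae_eq leb Omega (IH v) (IH w);
  qi_linear : forall (a : R) v w, V v -> V w ->
    ae_eq leb Omega (IH (fun x => a * v x + w x))
      (fun x => a * IH v x + IH w x);
  qi_surjective : forall v, VH v -> exists2 w, V w & ae_eq leb Omega (IH w) v;
  qi_projection : forall v, V v -> ae_eq leb Omega (IH (IH v)) (IH v);
  qi_stable_H1 : forall (T : 'I_(ncells M)) v, V v ->
    (meshsize M)^-1 * L2norm (cell T) (v \- IH v)
      + L2normv (cell T) (grad (IH v))
    <= C * L2normv (patch M (cell T)) (grad v);
  qi_stable_L2 : forall (T : 'I_(ncells M)) v, V v ->
    L2norm (cell T) (IH v) <= C * L2norm (patch M (cell T)) v }.

(* W = ker IH, and the functions of W that vanish outside D *)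
Definition W (IH : (E -> R) -> E -> R) : set (E -> R) :=
  [set w | V w /\ ae_eq leb Omega (IH w) (cst 0)].

Definition W_loc (IH : (E -> R) -> E -> R) (D : set E) : set (E -> R) :=
  [set w | W IH w /\ ae_eq leb (Omega `\` D) w (cst 0)].

(* q T j is the (a.e. unique) solution of the element corrector problem *)
Definition element_correctors (IH : (E -> R) -> E -> R) (l : option nat)
    (q : 'I_(ncells M) -> 'I_d -> E -> R) : Prop :=
  forall T j,
    W_loc IH (layer Omega l T) (q T j) /\
    forall w, W_loc IH (layer Omega l T) w ->
      \int[leb]_(x in layer Omega l T) dot (grad w x) (A x *m grad (q T j) x) =
      \int[leb]_(x in cell T) dot (grad w x) (A x *m unitv R j).

Variable q : 'I_(ncells M) -> 'I_d -> E -> R.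

Definition corrector (v : E -> R) (x : E) : R :=
  \sum_(T < ncells M) \sum_(j < d) cell_grad v T j ord0 * q T j x.

Definition Kmat (T K : 'I_(ncells M)) : 'M[R]_d :=
  \matrix_(j, k) ((vol (cell T) * vol (cell K))^-1 *
    dot (unitv R j) (vint (cell K) (fun x => A x *m grad (q T k) x))).

Definition AHmat (T K : 'I_(ncells M)) : 'M[R]_d :=
  ((T == K)%:R / vol (cell K)) *: ((vol (cell T))^-1 *: mint (cell T) A)
  - Kmat T K.

(* The cells overlap only in the Lebesgue-null mesh skeleton; the kernel is
   given the value 0 there. *)
Definition AH (x y : E) : 'M[R]_d :=
  \sum_(T < ncells M) \sum_(K < ncells M)
    (\1_((cell T)°) x * \1_((cell K)°) y) *: AHmat T K.

Definition afrak (v z : E -> R) : R :=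
  \int[leb]_(x in Omega) \int[leb]_(y in Omega)
    dot (grad v y) (AH x y *m grad z x).

Definition load (f v : E -> R) : R := \int[leb]_(x in Omega) (f x * v x).

End fem.

(* Main.v *)
(* For u, v in V_H both forms are sums over pairs of cells.  Testing
   a(u, (1 - C)v) expands by linearity into a(u, v) minus the terms
   (d_j v|_T) a(u, q_{T,j}); since grad u is constant on each cell and A is
   symmetric, a(u, w) = sum_K grad u|_K . int_K A grad w for every w in V.  On
   the other side the kernel is constant on T x K, so a^(l)(u, v) is the sum of
   |T||K| grad u|_K . (A_H|_{T,K} grad v|_T), and the volumes cancel.

   As [grad] is an arbitrarily chosen weak gradient and classes are represented
   by functions, this needs weak gradients to be unique almost everywhere (the
   fundamental lemma of the calculus of variations), to coincide with the
   classical gradient on cells where the function is affine (integration by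
   parts), and the cells to tile Omega up to a null set: they overlap only in
   hyperplanes, and a Lipschitz domain is the interior of its closure. *)
Require Import Defs.
From HB Require Import structures.
From mathcomp Require Import all_boot all_order all_algebra.
From mathcomp Require Import all_classical all_reals all_analysis.
From mathcomp Require Import measurable_realfun ess_sup_inf.
From mathcomp Require Import ring lra.

Set Implicit Arguments.
Unset Strict Implicit.
Unset Printing Implicit Defensive.

Import Order.TTheory GRing.Theory Num.Theory.
Import numFieldNormedType.Exports.

Local Open Scope classical_set_scope.
Local Open Scope ring_scope.

(** * Boxes, open sets and hyperplanes in R^d *)

(** The equivalence comes from an identity: the two forms agree at every pair of elements of V_H.
    Its algebra is finite, but each term is an integral of total functions whose values outside
    Omega and on null sets are arbitrary, so measure theory carries the weight.

    Lebesgue measure on R^d is built by adding one coordinate in front at a time. Boxes and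
    hyperplanes are therefore measured by induction on d, and integration by parts reduces, through
    Fubini in either order, to the fundamental theorem of calculus on a line.

    Uniqueness of weak gradients needs enough smooth functions of compact support. Products of
    exp(-1/t), with t the distance to either end of a box in each coordinate, provide them;
    rescaled, they tend to the indicator of the box, and a function whose integral over every small
    box is 0 vanishes almost everywhere.

    The iterated integral in [afrak] is evaluated by replacing each integrand almost everywhere by a
    step function on the open cells. *)

Section boxes.
Variables (R : realType) (d : nat).
Notation E := 'cV[R]_d.

Definition obox (a b : E) : set E :=
  [set x | forall i, a i ord0 < x i ord0 < b i ord0].

Definition cbox (a b : E) : set E :=
  [set x | forall i, a i ord0 <= x i ord0 <= b i ord0].

Lemma sub_obox_cbox (a b : E) : obox a b `<=` cbox a b.
Proof. by move=> x abx i; have /andP[/ltW-> /ltW->] := abx i. Qed.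

(** The topology comes from the max norm, so its balls are cubes and neighbourhoods can be handled
    one coordinate at a time. *)
Lemma nbhs_cV (x : E) (A : set E) :
  nbhs x A <-> exists2 e : R, 0 < e &
    forall y : E, (forall i, `|y i ord0 - x i ord0| < e) -> A y.
Proof.
split.
  move=> /nbhs_ballP[e /= e0 xA]; exists e => // y xy; apply: xA.
  split=> // i j; rewrite ord1 -ball_normE /ball_/= distrC; exact: xy.
move=> [e e0 xA]; apply/nbhs_ballP; exists e => // y [_ xy]; apply: xA => i.
by have := xy i ord0; rewrite -ball_normE /ball_/= distrC.
Qed.

Lemma open_coord (j : 'I_d) (U : set R) : open U ->
  open [set x : E | U (x j ord0)].
Proof.
move=> oU; rewrite openE => x /= Ux; apply/nbhs_cV.
have /nbhs_ballP[e /= e0 xU] := open_nbhs_nbhs (conj oU Ux).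
by exists e => // y xy; apply: xU; rewrite -ball_normE /ball_/= distrC.
Qed.

Lemma continuous_coord (j : 'I_d) : continuous (fun x : E => x j ord0).
Proof. by apply/continuousP => U oU; exact: open_coord. Qed.

Lemma measurable_box (I : 'I_d -> set R) : (forall i, measurable (I i)) ->
  measurable [set x : E | forall i, I i (x i ord0)].
Proof.
move=> mI; rewrite (_ : [set _ | _] =
    \bigcap_(i in [set: 'I_d]) ((fun x : E => x i ord0) @^-1` I i)); last first.
  by apply/seteqP; split=> [x + i _|x + i]; exact.
apply: fin_bigcap_measurable => // i _.
by rewrite -[X in measurable X]setTI; exact: measurable_cV_coord.
Qed.

Lemma measurable_obox (a b : E) : measurable (obox a b).
Proof.
rewrite (_ : obox a b = [set x : E | forall i, `]a i ord0, b i ord0[%classic (x i ord0)]).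
  exact: (@measurable_box (fun i => `]a i ord0, b i ord0[%classic)).
by apply/seteqP; split=> x abx i; have := abx i; rewrite /= in_itv.
Qed.

Lemma measurable_cbox (a b : E) : measurable (cbox a b).
Proof.
rewrite (_ : cbox a b = [set x : E | forall i, `[a i ord0, b i ord0]%classic (x i ord0)]).
  exact: (@measurable_box (fun i => `[a i ord0, b i ord0]%classic)).
by apply/seteqP; split=> x abx i; have := abx i; rewrite /= in_itv.
Qed.

Lemma closed_cbox (a b : E) : closed (cbox a b).
Proof.
move=> x clx i; rewrite leNgt (leNgt _ (b _ _)) -negb_or; apply/negP => ab.
have [|y [/(_ i) aby]] :=
    clx [set y : E | (y i ord0 < a i ord0) || (b i ord0 < y i ord0)].
  apply: open_nbhs_nbhs; split => //.
  rewrite (_ : [set _ | _] = [set y : E | (y i ord0 < a i ord0)]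
    `|` [set y : E | (b i ord0 < y i ord0)]).
    apply: openU; first exact: (@open_coord i _ (@open_lt R (a i ord0))).
    exact: (@open_coord i _ (@open_gt R (b i ord0))).
  by apply/seteqP; split=> y /=; [move/orP|move=> h; apply/orP].
by move=> /=; rewrite !ltNge -negb_and aby.
Qed.

(** Enumerates all pairs of rational corners. The default [(0, 0)] at numbers that code no pair is
    harmless: only boxes whose closure lies in a given open set are ever selected. *)
Definition rat_corner (n : nat) : E * E :=
  if @unpickle ('cV[rat]_d * 'cV[rat]_d)%type n is Some p
  then (map_mx ratr p.1, map_mx ratr p.2) else (0, 0).

(** The selection asks for the closed box to lie in U, so that a bump on the box is a test function
    on U. Countability gives both Borel measurability of U and the passage from null on boxes to
    null on U. *)
Lemma open_bigcup_obox (U : set E) : open U ->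
  U = \bigcup_(n in [set n | cbox (rat_corner n).1 (rat_corner n).2 `<=` U])
        obox (rat_corner n).1 (rat_corner n).2.
Proof.
move=> oU; apply/seteqP; split=> [x Ux|x [n nU /sub_obox_cbox]]; last exact: nU.
have /nbhs_cV[e e0 xU] := open_nbhs_nbhs (conj oU Ux).
have ltl i : x i ord0 - e < x i ord0 by rewrite ltrBlDr ltrDl.
have ltr i : x i ord0 < x i ord0 + e by rewrite ltrDl.
pose a : 'cV[rat]_d := \col_i projT1 (cid (rat_in_itvoo (ltl i))).
pose b : 'cV[rat]_d := \col_i projT1 (cid (rat_in_itvoo (ltr i))).
have aP i : x i ord0 - e < ratr (a i ord0) < x i ord0.
  by rewrite mxE; case: cid => q /=; rewrite in_itv.
have bP i : x i ord0 < ratr (b i ord0) < x i ord0 + e.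
  by rewrite mxE; case: cid => q /=; rewrite in_itv.
clearbody a b; exists (pickle (a, b)); rewrite /= /rat_corner pickleK/=.
  move=> y aby; apply: xU => i; have := aby i; rewrite !mxE.
  have /andP[? ?] := aP i; have /andP[? ?] := bP i => /andP[? ?].
  by rewrite ltr_norml; apply/andP; split; lra.
by move=> i; rewrite !mxE; have /andP[_ ->] := aP i; have /andP[-> _] := bP i.
Qed.

Lemma open_measurable_cV (U : set E) : open U -> measurable U.
Proof.
move=> /open_bigcup_obox ->; apply: bigcup_measurable => n _.
exact: measurable_obox.
Qed.

Lemma closed_measurable_cV (U : set E) : closed U -> measurable U.
Proof.
by move=> cU; rewrite -[U]setCK; apply: measurableC; apply: open_measurable_cV; exact: closed_openC.
Qed.

Lemma continuous_measurable_cV (f : E -> R) (D : set E) : measurable D ->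
  continuous f -> measurable_fun D f.
Proof.
move=> mD /continuousP cf.
apply: (measurability _ (RGenOpens.measurableE R)) => //.
move=> _ [_ [a [b ->] <-]]; apply: measurableI => //.
by apply: open_measurable_cV; exact/cf/interval_open.
Qed.

Lemma compact_cbox (a b : E) : compact (cbox a b).
Proof.
(* Compactness of products of segments is available for row vectors and is carried over by the
   continuous transposition. *)
have -> : cbox a b = trmx @` [set x : 'rV[R]_d | forall i, (fun i => `[a i ord0, b i ord0]%classic) i (x ord0 i)].
  apply/seteqP; split=> [x abx|_ [y aby <-] i].
    by exists x^T; [move=> i; rewrite /= in_itv/= mxE; exact: abx|rewrite trmxK].
  by rewrite mxE; have := aby i; rewrite /= in_itv.
apply: continuous_compact; last first.
  apply: (@rV_compact R d (fun i => `[a i ord0, b i ord0]%classic)) => i.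
  exact: segment_compact.
apply: continuous_subspaceT => x U /nbhs_cV[e e0 xU].
apply/nbhs_ballP; exists e => // y [_ xy]; apply: xU => i; rewrite !mxE distrC.
by have := xy ord0 i; rewrite -ball_normE.
Qed.

End boxes.

(** * Lebesgue measure of boxes, open sets and hyperplanes *)

Section lebesgue_box.
Variable R : realType.
Notation leb := (lebesgue_cV R).

Lemma lebesgue_box_recl n (I : 'I_n.+1 -> set R) : (forall i, measurable (I i)) ->
  leb n.+1 [set x | forall i, I i (x i ord0)] =
  (lebesgue_measure (I ord0) *
   leb n [set x | forall i, I (lift ord0 i) (x i ord0)])%E.
Proof.
move=> mI; rewrite -product_measure1E//=; [|exact: mI|exact: (@measurable_box _ _ (fun i => I (lift ord0 i)))].
rewrite /lebesgue_cV_step /pushforward; congr (_ _).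
apply/seteqP; split=> [[t x] /= h|[t x] /= [h1 h2] i].
  by split=> [|i]; [have := h ord0|have := h (lift ord0 i)];
    rewrite ?cV_cons0 ?cV_consS.
by case: (unliftP ord0 i) => [j|] ->; rewrite ?cV_cons0 ?cV_consS.
Qed.

Lemma lebesgue_cV0E (A : set 'cV[R]_0) : leb 0%N A = \d_(0 : 'cV[R]_0) A.
Proof. by []. Qed.

Lemma lebesgue_cbox_lty n (a b : 'cV[R]_n) : (leb n (cbox a b) < +oo)%E.
Proof.
elim: n a b => [|n IHn] a b.
  rewrite lebesgue_cV0E diracE; case: (_ \in _) => /=; exact: ltry.
rewrite (_ : cbox a b =
    [set x | forall i, `[a i ord0, b i ord0]%classic (x i ord0)]); last first.
  by apply/seteqP; split=> x abx i; have := abx i; rewrite /= in_itv.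
rewrite (@lebesgue_box_recl n (fun i => `[a i ord0, b i ord0]%classic))//.
apply: lte_mul_pinfty => //.
  by rewrite ge0_fin_numE// lebesgue_measure_itv; case: ifP => _; rewrite -?EFinB ltry.
apply: le_lt_trans (IHn (\col_i a (lift ord0 i) ord0) (\col_i b (lift ord0 i) ord0)).
rewrite le_eqVlt; apply/orP; left; apply/eqP; congr (_ _).
by apply/seteqP; split=> x abx i; have := abx i; rewrite /= !mxE in_itv.
Qed.

Lemma lebesgue_obox_gt0 n (a b : 'cV[R]_n) :
  (forall i, a i ord0 < b i ord0) -> (0 < leb n (obox a b))%E.
Proof.
elim: n a b => [|n IHn] a b ab.
  by rewrite lebesgue_cV0E diracE mem_set// => -[].
rewrite (_ : obox a b =
    [set x | forall i, `]a i ord0, b i ord0[%classic (x i ord0)]); last first.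
  by apply/seteqP; split=> x abx i; have := abx i; rewrite /= in_itv.
rewrite (@lebesgue_box_recl n (fun i => `]a i ord0, b i ord0[%classic))//; apply: mule_gt0.
  by rewrite lebesgue_measure_itv/= lte_fin ab -EFinB lte_fin subr_gt0 ab.
have := IHn (\col_i a (lift ord0 i) ord0) (\col_i b (lift ord0 i) ord0).
move=> /(_ _)/lt_le_trans; apply; first by move=> i; rewrite !mxE.
rewrite le_eqVlt; apply/orP; left; apply/eqP; congr (_ _).
by apply/seteqP; split=> x abx i; have := abx i; rewrite /= !mxE in_itv.
Qed.

Lemma lebesgue_open_gt0 n (U : set 'cV[R]_n) : open U -> U !=set0 ->
  (0 < leb n U)%E.
Proof.
move=> oU [x Ux]; have /nbhs_cV[e e0 xU] := open_nbhs_nbhs (conj oU Ux).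
have := @lebesgue_obox_gt0 n (x - const_mx e) (x + const_mx e).
move=> /(_ _)/lt_le_trans; apply.
  by move=> i; rewrite !mxE ltrD2l gtrN.
apply: le_measure; rewrite ?inE; [exact: measurable_obox|exact: open_measurable_cV|].
move=> y xy; apply: xU => i; have := xy i; rewrite !mxE => /andP[? ?].
by rewrite ltr_norml; apply/andP; split; lra.
Qed.

Lemma measurable_hyperplane n (c : R) (b : 'cV[R]_n) :
  measurable [set x : 'cV[R]_n | c + dot b x = 0].
Proof.
have mf : measurable_fun setT (fun x : 'cV[R]_n => c + dot b x).
  apply: measurable_funD => //; apply: measurable_sum => i.
  by apply: measurable_funM => //; exact: measurable_cV_coord.
by have := mf measurableT _ (measurable_set1 0); rewrite setTI.
Qed.

Lemma dot_cons n (b : 'cV[R]_n.+1) (p : R * 'cV[R]_n) :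
  dot b (cV_cons p) =
  b ord0 ord0 * p.1 + dot (\col_i b (lift ord0 i) ord0) p.2.
Proof.
rewrite /dot big_ord_recl cV_cons0; congr (_ + _).
by apply: eq_bigr => i _; rewrite cV_consS mxE.
Qed.

(** Slicing along the first coordinate: if the remaining part [b'] of the normal is nonzero, every
    slice is a hyperplane of lower dimension, null by induction; otherwise the slice is nonempty for
    a single value of that coordinate. *)
Lemma lebesgue_hyperplane n (c : R) (b : 'cV[R]_n) : b != 0 ->
  leb n [set x | c + dot b x = 0] = 0%E.
Proof.
elim: n c b => [|n IHn] c b b0.
  by case/eqP: b0; apply/colP => -[].
have mH : measurable (@cV_cons R n @^-1` [set x | c + dot b x = 0]).
  rewrite -[X in measurable X]setTI; apply: measurable_cV_cons => //.
  exact: measurable_hyperplane.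
pose b' : 'cV[R]_n := \col_i b (lift ord0 i) ord0.
have sliceE t : xsection (@cV_cons R n @^-1` [set x | c + dot b x = 0]) t =
    [set x | (c + b ord0 ord0 * t) + dot b' x = 0].
  by apply/seteqP; split=> x; rewrite /xsection/= inE/= dot_cons addrA.
rewrite /= /lebesgue_cV_step /pushforward /product_measure1/=.
under eq_integral => t _ do rewrite /= sliceE.
have [b'0|] := eqVneq b' 0; last first.
  by move=> b'0; under eq_integral => t _ do rewrite IHn//; rewrite integral0.
have b00 : b ord0 ord0 != 0.
  apply: contra b0 => /eqP b00; apply/eqP/colP => i; rewrite mxE.
  case: (unliftP ord0 i) => [j|] -> //.
  by move/colP/(_ j) : b'0; rewrite !mxE.
(* With [b' = 0] the equation reads c + b_0 t = 0, so the slice measure is supported on one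
   point. *)
set f := fun t => _; have f0 t : t != - c / b ord0 ord0 -> f t = 0%E.
  move=> tc; rewrite /f (_ : [set _ | _] = set0) ?measure0//.
  apply/seteqP; split=> x //=; rewrite b'0 /dot big1 ?addr0; last first.
    by move=> i _; rewrite mxE mul0r.
  move=> /eqP; rewrite addrC addr_eq0 => /eqP tE.
  by move: tc; rewrite -tE mulrAC mulfV ?mul1r ?eqxx.
rewrite (_ : f = (fun t => (f t)) \_ [set - c / b ord0 ord0]); last first.
  apply/funext => t; rewrite patchE; case: ifPn => // /negP.
  by rewrite inE/= => /eqP; exact: f0.
by rewrite -integral_mkcond integral_set1.
Qed.

End lebesgue_box.

(** * Integrals that ignore null sets *)

Section null_set.
Context d (T : measurableType d) (R : realType) (mu : {measure set T -> \bar R}).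
Import HBNNSimple.

(** A simple function below f, multiplied by the indicator of the complement of N, keeps its
    integral and lies below g: off N because f = g there, on N because it is 0 and g is
    nonnegative. *)
Lemma ereal_sup_sintegral_null (N : set T) (f g : T -> \bar R) :
  measurable N -> mu N = 0%E -> (forall x, (0 <= g x)%E) ->
  (forall x, ~ N x -> f x = g x) ->
  (ereal_sup [set sintegral mu h |
     h in [set h : {nnsfun T >-> R} | forall x, ((h x)%:E <= f x)%E]] <=
   ereal_sup [set sintegral mu h |
     h in [set h : {nnsfun T >-> R} | forall x, ((h x)%:E <= g x)%E]])%E.
Proof.
move=> mN N0 g0 fg; apply: ge_ereal_sup => _ [h /= hf <-].
apply: ereal_sup_ubound; exists (proj_nnsfun h (measurableC mN)) => /=.
  move=> x; rewrite mindicE; case: (boolP (x \in ~` N)) => [|_].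
    by rewrite inE => Nx; rewrite mulr1 -fg.
  by rewrite mulr0.
rewrite -!integralT_nnsfun; apply: ge0_ae_eq_integral => //.
- by apply/measurable_EFinP.
- by apply/measurable_EFinP.
- by move=> x _; rewrite lee_fin.
- by move=> x _; rewrite lee_fin.
exists N; split => // x /= /not_implyP[_]; apply: contra_notP => Nx.
by rewrite mindicE mem_set// mulr1.
Qed.

(* No measurability is assumed: the lower integral does not see null sets. *)
Lemma integral_null_set (N D1 D2 : set T) (f g : T -> \bar R) :
  measurable N -> mu N = 0%E ->
  (forall x, ~ N x -> (f \_ D1) x = (g \_ D2) x) ->
  (\int[mu]_(x in D1) f x = \int[mu]_(x in D2) g x)%E.
Proof.
move=> mN N0 fg; rewrite /integral; congr (_ - _)%E;
  by apply/eqP; rewrite eq_le; apply/andP; split;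
  apply: (ereal_sup_sintegral_null mN N0) => // x /fg;
  rewrite ?funeposE ?funenegE => ->.
Qed.

Lemma Rintegral_null_set (N D1 D2 : set T) (f g : T -> R) :
  measurable N -> mu N = 0%E ->
  (forall x, ~ N x -> (f \_ D1) x = (g \_ D2) x) ->
  \int[mu]_(x in D1) f x = \int[mu]_(x in D2) g x.
Proof.
move=> mN N0 fg; congr fine; apply: (integral_null_set mN N0) => x Nx.
by rewrite -[fun x => (f x)%:E]/(EFin \o f) -[fun x => (g x)%:E]/(EFin \o g) !restrict_EFin/= fg.
Qed.

End null_set.

(** * Smooth bump functions *)

Section flat.
Variable R : realType.

(* The functions p(1/t) exp(-1/t), extended by 0, are stable under derivation
   (is_derive_flat), hence smooth. *)
Definition flat (p : {poly R}) (t : R) : R :=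
  if 0 < t then p.[t^-1] * expR (- t^-1) else 0.

(** For u >= 1 and n = [size p], |p(u)| is at most u^n times the sum of the absolute coefficients,
    while exp(-u) <= (n+1)!/u^(n+1) by the exponential series. The spare power leaves C/u. *)
Lemma horner_expRN_bound (p : {poly R}) : exists2 C : R, 0 <= C &
  forall u, 1 <= u -> `|p.[u] * expR (- u)| <= C / u.
Proof.
exists ((\sum_(i < size p) `|p`_i|) * (size p).+1`!%:R).
  by rewrite mulr_ge0// sumr_ge0.
move=> u u1; have u0 : 0 < u := lt_le_trans ltr01 u1.
set n := size p; set S := \sum_(i < n) _.
have pu : `|p.[u]| <= S * u ^+ n.
  rewrite horner_coef; apply: le_trans (ler_norm_sum _ _ _) _.
  rewrite mulr_suml; apply: ler_sum => i _.
  rewrite normrM ler_wpM2l// ger0_norm; last by rewrite exprn_ge0// ltW.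
  by apply: ler_weXn2l => //; exact: ltnW.
have eu : expR (- u) <= n.+1`!%:R / u ^+ n.+1.
  rewrite expRN -[leRHS]invf_div lef_pV2 ?posrE ?expR_gt0//; last first.
    by rewrite divr_gt0// ?exprn_gt0// ltr0n fact_gt0.
  by apply: le_trans (expR_ge1Dxn n (ltW u0)); rewrite lerDr.
rewrite normrM (ger0_norm (expR_ge0 _)).
apply: le_trans (ler_pM (normr_ge0 _) (expR_ge0 _) pu eu) _.
rewrite le_eqVlt; apply/orP; left; apply/eqP; rewrite exprS.
by field; rewrite expf_neq0 gt_eqF.
Qed.

(** The bound C/u read at u = 1/t. It controls the difference quotient at 0 in the next lemma. *)
Lemma flat_bound (p : {poly R}) : exists2 C : R, 0 <= C &
  forall t, t <= 1 -> `|flat p t| <= C * `|t|.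
Proof.
have [C C0 pC] := horner_expRN_bound p; exists C => // t t1.
rewrite /flat; case: ifPn => [t0|_]; last by rewrite normr0 mulr_ge0.
by rewrite (gtr0_norm t0) -[t in leRHS]invrK pC// invf_ge1.
Qed.

(** For t > 0 the derivative of p(1/t) exp(-1/t) is t^(-2) (p - p')(1/t) exp(-1/t), again of the
    same form; for t < 0 the function is locally 0. *)
Lemma is_derive_flat (p : {poly R}) (t : R) :
  is_derive t (1 : R) (flat p) (flat ('X^2 * (p - p^`())) t).
Proof.
have [t0|t0|->] := ltgtP t 0.
- have E : \forall s \near t, (cst 0 : R -> R) s = flat p s.
    near=> s; rewrite /flat ltNge ifF//; apply/negbTE; rewrite negbK ltW//.
    by near: s; exact: lt_nbhsl.
  rewrite /flat ltNge (ltW t0)/=; apply: DeriveDef.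
    by apply: (near_eq_derivable E); exact: derivable_cst.
  by rewrite -(near_eq_derive _ E) derive_cst.
- pose g (s : R) := p.[s^-1] * expR (- s^-1).
  have E : \forall s \near t, g s = flat p s.
    near=> s; rewrite /flat ifT//; near: s; exact: lt_nbhsr.
  have tn0 : t != 0 by rewrite gt_eqF.
  have dV : is_derive t (1 : R) (fun s => s^-1) (- t ^- 2).
    have := @is_deriveV R id t 1 1 tn0 (is_derive_id _ _).
    by rewrite /GRing.scale/= mulr1.
  have dp := is_derive1_comp (is_derive_poly p t^-1) dV.
  have de := @is_derive1_comp R expR (fun s => - s^-1) t _ _
    (is_derive_expR (- t^-1)) (is_deriveN dV).
  have dg : is_derive t (1 : R) g (flat ('X^2 * (p - p^`())) t).
    have := is_deriveM dp de; rewrite /flat t0.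
    congr is_derive; rewrite /GRing.scale/= !hornerE/=; field.
    exact: tn0.
  apply: DeriveDef.
    by apply: (near_eq_derivable E); exact: ex_derive.
  by rewrite -(near_eq_derive _ E) derive_val.
(* At 0 the difference quotient [flat p h] / h equals [flat ('X * p) h], so the linear bound for
   ['X * p] makes it tend to 0. *)
- have [C C0 pC] := flat_bound ('X * p).
  rewrite [X in is_derive _ _ _ X]/flat ltxx.
  suff cv : h^-1 *: ((flat p \o shift 0) (h *: 1) - flat p 0) @[h --> 0^'] --> (0 : R).
    by apply: DeriveDef; [apply/cvg_ex; exists 0|exact/cvg_lim].
  apply/cvgrPdist_le => e e0; near=> h.
  rewrite sub0r normrN /= addr0 /flat ltxx subr0 /GRing.scale/= mulr1.
  have h1 : h <= 1.
    by apply: le_trans (ler_norm h) _; near: h; exact: dnbhs0_le.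
  have -> : h^-1 * (if 0 < h then p.[h^-1] * expR (- h^-1) else 0) = flat ('X * p) h.
    by rewrite /flat; case: ifP; rewrite ?mulr0// hornerM hornerX mulrA.
  apply: le_trans (pC _ h1) _.
  have hC : `|h| <= e / (C + 1).
    near: h; apply: dnbhs0_le; rewrite divr_gt0//; lra.
  apply: le_trans (ler_wpM2l C0 hC) _.
  rewrite mulrA ler_pdivrMr; nra.
Unshelve. all: by end_near. Qed.

Definition bump (t : R) : R := flat 1 t.

Lemma bumpE t : bump t = if 0 < t then expR (- t^-1) else 0.
Proof. by rewrite /bump /flat hornerC mul1r. Qed.

Lemma bump_ge0 t : 0 <= bump t.
Proof. by rewrite bumpE; case: ifP => // _; exact: expR_ge0. Qed.

Lemma bump_le1 t : bump t <= 1.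
Proof.
rewrite bumpE; case: ifP => // t0; rewrite -expR0 ler_expR.
by rewrite oppr_le0 invr_ge0 ltW.
Qed.

Lemma bump_cvg (t : R) : 0 < t -> bump (n.+1%:R * t) @[n --> \oo] --> (1 : R).
Proof.
move=> t0.
have -> : (fun n => bump (n.+1%:R * t)) = (fun n => expR (- (harmonic n * t^-1))).
  apply/funext => n; rewrite bumpE ifT; last by rewrite mulr_gt0.
  by rewrite /harmonic/= invfM.
rewrite -expR0; apply: continuous_cvg; first exact: continuous_expR.
rewrite -oppr0; apply: cvgN; rewrite -(mul0r t^-1); apply: cvgMl.
exact: cvg_harmonic.
Qed.

End flat.

(** * Smooth functions of several variables and bumps on boxes *)

Section smooth.
Variables (R : realType) (d : nat).
Notation E := 'cV[R]_d.
Implicit Types f g : E -> R.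

Lemma class_C_continuous k f : class_C k f -> continuous f.
Proof. by case: k => [[]|k []]. Qed.

Lemma class_CSP k f : class_C k.+1 f ->
  forall j, (forall x, derivable f x (unitv R j)) /\ class_C k (partial j f).
Proof. by case. Qed.

Lemma class_CW k f : class_C k.+1 f -> class_C k f.
Proof.
elim: k f => [|k IHk] f; first by move=> [].
move=> [cf df]; split=> // j; have [dfj Cf] := df j.
by split=> //; exact: IHk.
Qed.

Lemma class_C_cst k (c : R) : class_C k (cst c : E -> R).
Proof.
elim: k c => [|k IHk] c; first by split=> //; exact: cst_continuous.
split; first exact: cst_continuous.
move=> j; split; first by move=> x; exact: derivable_cst.
rewrite (_ : partial j _ = cst 0); first exact: IHk.
by apply/funext => x; rewrite /partial derive_cst.
Qed.

Lemma class_CD k f g : class_C k f -> class_C k g ->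
  class_C k (fun x => f x + g x).
Proof.
elim: k f g => [|k IHk] f g [cf df] [cg dg].
  by split=> // x; exact: cvgD (cf x) (cg x).
split; first by move=> x; exact: cvgD (cf x) (cg x).
move=> j; have [dfj Cf] := df j; have [dgj Cg] := dg j; split.
  by move=> x; exact: derivableD.
rewrite (_ : partial j _ = (fun x => partial j f x + partial j g x)).
  exact: IHk.
by apply/funext => x; rewrite /partial deriveD.
Qed.

Lemma partialM j f g x : derivable f x (unitv R j) ->
  derivable g x (unitv R j) ->
  partial j (fun x => f x * g x) x = partial j f x * g x + f x * partial j g x.
Proof.
by move=> df dg; rewrite /partial (deriveM df dg) addrC /GRing.scale/= mulrC.
Qed.

Lemma class_CM k f g : class_C k f -> class_C k g ->
  class_C k (fun x => f x * g x).
Proof.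
elim: k f g => [|k IHk] f g.
  by move=> [cf df] [cg dg]; split=> // x; exact: cvgM (cf x) (cg x).
move=> /[dup] Cf [cf df] /[dup] Cg [cg dg].
split; first by move=> x; exact: cvgM (cf x) (cg x).
move=> j; have [dfj Cfj] := df j; have [dgj Cgj] := dg j; split.
  by move=> x; exact: derivableM.
rewrite (_ : partial j _ =
    (fun x => partial j f x * g x + f x * partial j g x)).
  by apply: class_CD; apply: IHk => //; exact: class_CW.
by apply/funext => x; rewrite partialM.
Qed.

Lemma class_C_prod k (I : Type) (r : seq I) (F : I -> E -> R) :
  (forall i, class_C k (F i)) -> class_C k (fun x => \prod_(i <- r) F i x).
Proof.
move=> CF; elim: r => [|i r IHr].
  by under eq_fun do rewrite big_nil; exact: class_C_cst.
by under eq_fun do rewrite big_cons; exact: class_CM.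
Qed.

Lemma is_derive_coord (h : R -> R) (dh : R) (i j : 'I_d) (x : E) :
  is_derive (x i ord0) (1 : R) h dh ->
  is_derive x (unitv R j) (fun x => h (x i ord0)) ((i == j)%:R * dh).
Proof.
move=> [hd hv].
have E1 : (fun t : R => t^-1 *: (((fun x : E => h (x i ord0)) \o shift x)
    (t *: unitv R j) - h (x i ord0))) =
  (fun t : R => t^-1 *: ((h \o shift (x i ord0)) (t *: (i == j)%:R) - h (x i ord0))).
  by apply/funext => t /=; rewrite !mxE andbT.
case: (i == j) E1 => E1; last first.
  rewrite mul0r.
  have cv0 : (fun t : R => t^-1 *: ((h \o shift (x i ord0)) (t *: 0) - h (x i ord0))) =
      (fun=> 0) by apply/funext => t /=; rewrite scaler0 add0r subrr scaler0.
  apply: DeriveDef; rewrite ?/derivable ?/derive E1 cv0.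
    exact: is_cvg_cst.
  exact: lim_cst.
rewrite mul1r; apply: DeriveDef; rewrite ?/derivable ?/derive E1//.
Qed.

(** The induction on k replaces h by its derivative, so it has to run over a whole set S of
    functions stable under derivation. *)
Lemma class_C_coord (S : set (R -> R)) :
  (forall h, S h -> exists2 h', S h' & forall t, is_derive t (1 : R) h (h' t)) ->
  forall k (i : 'I_d) h, S h -> class_C k (fun x : E => h (x i ord0)).
Proof.
move=> Sd k i; have Sc h : S h -> continuous (fun x : E => h (x i ord0)).
  move=> /Sd[h' _ hh'] x.
  apply: (@continuous_comp _ _ _ (fun x : E => x i ord0) h).
    exact: continuous_coord.
  by apply/differentiable_continuous/derivable1_diffP; have [] := hh' (x i ord0).
elim: k => [|k IHk] h Sh; first by split=> //; exact: Sc.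
have [h' Sh' hh'] := Sd _ Sh; split; first exact: Sc.
move=> j; split; first by move=> x; have [] := is_derive_coord j (hh' (x i ord0)).
rewrite (_ : partial j _ = (fun x => (i == j)%:R * h' (x i ord0))).
  by apply: class_CM; [exact: class_C_cst|exact: IHk].
by apply/funext => x; have [_] := is_derive_coord j (hh' (x i ord0)).
Qed.

Lemma class_C_bump k (i : 'I_d) (a b : R) :
  class_C k (fun x : E => bump (a * x i ord0 + b)).
Proof.
pose S := [set h : R -> R | exists c p, h = fun t => c * flat p (a * t + b)].
apply: (@class_C_coord S _ k i (fun t => bump (a * t + b))) => [_ [c [p ->]]|]; last first.
  by exists 1, 1; apply/funext => t; rewrite mul1r.
exists (fun t => (a * c) * flat ('X^2 * (p - p^`())) (a * t + b)).
  by exists (a * c), ('X^2 * (p - p^`())).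
move=> t.
have d1 : is_derive t (1 : R) (fun t => a * t + b) a.
  have := is_deriveD (is_deriveZ a (is_derive_id t (1 : R))) (is_derive_cst b t 1).
  by rewrite addr0 /GRing.scale/= mulr1.
have d2 := @is_derive1_comp R (flat p) (fun t => a * t + b) t _ _
  (is_derive_flat p _) d1.
have := is_deriveZ c d2; congr is_derive; rewrite /GRing.scale/=; ring.
Qed.

(* bump (n t) = exp (- 1 / (n t)) tends to the indicator of t > 0. *)
Definition box_bump (a b : E) (n : nat) (x : E) : R :=
  \prod_(i < d) (bump (n.+1%:R * (x i ord0 - a i ord0)) *
                 bump (n.+1%:R * (b i ord0 - x i ord0))).

Lemma box_bump_ge0 a b n x : 0 <= box_bump a b n x.
Proof. by apply: prodr_ge0 => i _; rewrite mulr_ge0// bump_ge0. Qed.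

Lemma box_bump_le1 a b n x : box_bump a b n x <= 1.
Proof.
apply: prodr_ile1 => i _; apply/andP; split.
  by rewrite mulr_ge0 ?bump_ge0.
by rewrite mulr_ile1 ?bump_ge0 ?bump_le1.
Qed.

Lemma box_bump_notin a b n x : ~ obox a b x -> box_bump a b n x = 0.
Proof.
move=> /existsNP[i xi]; rewrite /box_bump (bigD1 i)//=.
suff -> : bump (n.+1%:R * (x i ord0 - a i ord0)) *
          bump (n.+1%:R * (b i ord0 - x i ord0)) = 0 by rewrite mul0r.
rewrite !bumpE !pmulr_rgt0// !subr_gt0.
by case: ltP => ai; case: ltP => bi; rewrite ?mul0r ?mulr0//; case: xi; rewrite ai.
Qed.

Lemma box_bump_cvg a b x : box_bump a b n x @[n --> \oo] --> (\1_(obox a b) x : R).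
Proof.
rewrite indicE; case: (boolP (x \in obox a b)) => [|/negP]; rewrite inE => abx.
  rewrite /box_bump; elim: (index_enum _) => [|i r IHr].
    by under eq_cvg do rewrite big_nil; exact: cvg_cst.
  under eq_cvg do rewrite big_cons.
  have /andP[] := abx i; rewrite -subr_gt0 -(subr_gt0 (x i ord0)).
  move=> /bump_cvg ai /bump_cvg bi.
  by have := cvgM (cvgM ai bi) IHr; rewrite !mul1r; apply; exact: eventually_filter.
rewrite (_ : (fun n => _) = cst 0); first exact: cvg_cst.
by apply/funext => n; exact: box_bump_notin.
Qed.

Lemma class_C_box_bump k a b n : class_C k (box_bump a b n).
Proof.
apply: class_C_prod => i; apply: class_CM.
  rewrite (_ : (fun x => _) = (fun x : E =>
    bump (n.+1%:R * x i ord0 + - (n.+1%:R * a i ord0)))); first exact: class_C_bump.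
  by apply/funext => x; rewrite mulrBr.
rewrite (_ : (fun x => _) = (fun x : E =>
    bump (- n.+1%:R * x i ord0 + n.+1%:R * b i ord0))); first exact: class_C_bump.
by apply/funext => x; rewrite mulrBr addrC mulNr.
Qed.

(** The bump vanishes off the open box, so its support lies in the closed box, which is compact. *)
Lemma test_function_box_bump (D : set E) a b n : cbox a b `<=` D ->
  test_function D (box_bump a b n).
Proof.
move=> abD; have sab : closure [set x | box_bump a b n x != 0] `<=` cbox a b.
  apply: (@subset_trans _ (closure (cbox a b))).
    apply: closure_subset => x /= h; apply: sub_obox_cbox.
    apply: contrapT => abx; move: h; rewrite (_ : box_bump a b n x = 0) ?eqxx//.
    exact: box_bump_notin.
  by rewrite -(closure_id _).1 //; exact: closed_cbox.
split; first by move=> k; exact: class_C_box_bump.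
  by apply: subclosed_compact sab; [exact: closed_closure|exact: compact_cbox].
exact: subset_trans abD.
Qed.

End smooth.

(** * Fundamental lemma of the calculus of variations *)

Section fundamental_lemma.
Variables (R : realType) (d : nat).
Notation E := 'cV[R]_d.
Notation leb := (lebesgue_cV R d).

Definition orthant (a : E) : set E := [set x | forall i, a i ord0 < x i ord0].

(** Orthants form a generating family stable under intersection, and a box cut by an orthant is
    again a box. *)
Lemma measurable_cV_orthant :
  @measurable _ E = <<s range orthant >>.
Proof.
apply/seteqP; split.
  apply: smallest_sub; first exact: smallest_sigma_algebra.
  rewrite -bigcup_seq => A [i _ [B mB <-]].
  pose T' := g_sigma_algebraType (range orthant).
  have mi : measurable_fun [set: T'] (fun x : T' => (x : E) i ord0).
    apply: (measurability _ (RGenOInfty.measurableE R)) => //.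
    move=> _ [_ [c ->] <-]; rewrite setTI.
    (* The half-space x_i > c is the union of the orthants with corner c in direction i and -n in
       the others; an n above the sum of all |x_j| serves every coordinate at once. *)
    rewrite (_ : _ @^-1` _ = \bigcup_n
        orthant (\col_j if j == i then c else - n%:R)).
      apply: bigcupT_measurable => n; apply: sub_sigma_algebra.
      by exists (\col_j if j == i then c else - n%:R).
    apply/seteqP; split=> [x /=|x [n _ /(_ i)]]; last first.
      by rewrite mxE eqxx /= in_itv/= andbT.
    rewrite in_itv/= andbT => cx.
    exists (Num.bound (\sum_j `|(x : E) j ord0|)) => //= j; rewrite mxE.
    case: eqP => [->//|_]; rewrite ltrNl.
    apply: le_lt_trans (archi_boundP _); last exact: sumr_ge0.
    rewrite (bigD1 j)//= -[leLHS]addr0 lerD//; last exact: sumr_ge0.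
    by rewrite -normrN ler_norm.
  exact: mi.
apply: smallest_sub; first exact: sigma_algebra_measurable.
move=> _ [a _ <-].
rewrite (_ : orthant a = [set x : E | forall i, `]a i ord0, +oo[%classic (x i ord0)]).
  exact: (@measurable_box _ _ (fun i => `]a i ord0, +oo[%classic)).
by apply/seteqP; split=> x h i; have := h i; rewrite /= in_itv/= andbT.
Qed.

Lemma orthant_setI_closed : setI_closed (range orthant).
Proof.
move=> _ _ [a _ <-] [b _ <-].
exists (\col_i Num.max (a i ord0) (b i ord0)) => //.
apply/seteqP; split=> [x h|x [h1 h2] i].
  by split=> i; have := h i; rewrite mxE gt_max => /andP[].
by rewrite mxE gt_max h1 h2.
Qed.

Section test.
Variables (D : set E) (g : E -> R).
Hypothesis mg : measurable_fun D g.
Hypothesis mD : measurable D.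
Hypothesis ig : forall a b, cbox a b `<=` D ->
  leb.-integrable (cbox a b) (EFin \o g).
Hypothesis g0 : forall phi, test_function D phi ->
  \int[leb]_(x in D) (g x * phi x) = 0.

(** Dominated convergence, with |g| as dominating function: g times the n-th bump has integral 0 by
    hypothesis and tends to g on the open box. *)
Lemma integral_obox_test (a b : E) : cbox a b `<=` D ->
  (\int[leb]_(x in obox a b) (g x)%:E = 0)%E.
Proof.
move=> abD; have oD : obox a b `<=` D := subset_trans (@sub_obox_cbox _ _ _ _) abD.
have igo : leb.-integrable (obox a b) (EFin \o g).
  apply: integrableS (ig abD); [exact: measurable_cbox|exact: measurable_obox|].
  exact: sub_obox_cbox.
have mgo : measurable_fun (obox a b) g.
  exact: measurable_funS oD mg.
have mphi n : measurable_fun (obox a b) (box_bump a b n).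
  apply: continuous_measurable_cV; first exact: measurable_obox.
  exact: (class_C_continuous (class_C_box_bump 0 a b n)).
have := @dominated_convergence _ _ R leb _ (measurable_obox a b)
  (fun n x => (g x * box_bump a b n x)%:E) (EFin \o g)
  (fun x => `|(g x)%:E|%E).
case.
- by move=> n; apply/measurable_EFinP; exact: measurable_funM.
- exact/measurable_EFinP.
- apply: aeW => x abx; apply: cvg_EFin; first exact: nearW.
  rewrite -[X in _ --> X]mulr1; apply: cvgMr.
  by have := @box_bump_cvg R d a b x; rewrite indicE mem_set.
- exact: integrable_abse.
- apply: aeW => x n _; rewrite lee_fin normrM (ger0_norm (box_bump_ge0 _ _ _ _)).
  by rewrite ler_piMr// box_bump_le1.
move=> _ _ /cvg_lim h; rewrite -[LHS]h//.
rewrite (_ : (fun n => _) = cst 0%E); first exact: lim_cst.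
apply/funext => n /=.
have := g0 (test_function_box_bump n abD); rewrite Rintegral_mkcond.
rewrite (_ : _ \_ D = (fun x => g x * box_bump a b n x) \_ (obox a b)).
  rewrite -Rintegral_mkcond => h0; rewrite -[LHS]fineK ?[fine _]h0//.
  apply: integrable_fin_num => //; first exact: measurable_obox.
  apply: le_integrable igo; first exact: measurable_obox.
    by apply/measurable_EFinP; exact: measurable_funM.
  move=> x _; rewrite lee_fin normrM (ger0_norm (box_bump_ge0 _ _ _ _)).
  by rewrite ler_piMr// box_bump_le1.
apply/funext => x; rewrite !patchE.
case: (boolP (x \in obox a b)) => [|/negP]; rewrite inE => abx.
  by rewrite mem_set//; exact: oD.
by rewrite box_bump_notin// mulr0; case: ifP.
Qed.

(* Intersecting a box with an orthant only raises its lower corner, so the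
   pi-lambda theorem for orthants applies inside a fixed box. *)
Lemma ae_eq0_obox (a b : E) : cbox a b `<=` D ->
  ae_eq leb (obox a b) (EFin \o g) (cst 0%E).
Proof.
move=> abD; pose B := obox a b.
have mB : measurable B by exact: measurable_obox.
have igB : leb.-integrable B (EFin \o g).
  apply: integrableS (ig abD) => //; first exact: measurable_cbox.
  exact: sub_obox_cbox.
have igS S : measurable S -> leb.-integrable (B `&` S) (EFin \o g).
  by move=> mS; apply: integrableS igB => //; exact: measurableI.
suff IS S : measurable S -> (\int[leb]_(x in B `&` S) (g x)%:E = 0)%E.
  apply: (integral_ae_eq mB igB) => // S SB mS.
  by rewrite integral0 -(setIidr SB) IS.
rewrite {1}measurable_cV_orthant; move: S.
apply: (@dynkin_induction _ E _
  (fun S => (\int[leb]_(x in B `&` S) (g x)%:E = 0)%E)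
  measurable_cV_orthant orthant_setI_closed).
- by rewrite setIT; exact: integral_obox_test.
- move=> _ [c _ <-].
  rewrite (_ : B `&` _ = obox (\col_i Num.max (a i ord0) (c i ord0)) b).
    apply: integral_obox_test; apply: subset_trans abD => x h i.
    by have := h i; rewrite mxE ge_max -andbA => /and3P[-> _ ->].
  apply/seteqP; split=> [x [h1 h2] i|x h].
    by rewrite mxE gt_max h2 andbT.
  by split=> i; have := h i; rewrite mxE gt_max -andbA => /and3P[h1 h2 h3];
    rewrite ?h1.
- move=> S mS BS.
  have := integral_obox_test abD; rewrite -/B -{1}(setUIDK B S).
  rewrite integral_setU ?BS ?add0e ?setDE//.
  - exact: measurableI.
  - by apply: measurableI => //; exact: measurableC.
  - rewrite -setDE setUIDK; exact: (measurable_int _ igB).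
  - by rewrite -setDE; apply/disj_setPS => x [[_ ?] [_ ?]].
- move=> F mF tF BF; rewrite setI_bigcupr integral_bigcup.
  + by apply: eseries0 => n _ _; exact: BF.
  + exact: trivIset_setIl.
  + by move=> n; exact: measurableI.
  + rewrite -setI_bigcupr; apply: igS; exact: bigcupT_measurable.
Qed.

(** D is a countable union of rational boxes with closure in D, and g is 0 almost everywhere on
    each. *)
Lemma test_function_ae_eq0 : open D -> ae_eq leb D g (cst 0).
Proof.
move=> oD; rewrite /ae_eq/=.
pose P := [set n | cbox (rat_corner R d n).1 (rat_corner R d n).2 `<=` D].
have neg n : leb.-negligible
    (if n \in P then obox (rat_corner R d n).1 (rat_corner R d n).2 `&`
       [set x | g x <> 0] else set0).
  case: (boolP (n \in P)) => [|_]; last exact: negligible_set0.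
  rewrite inE => /ae_eq0_obox; apply: negligibleS => x [h1 /= h2].
  by move=> /(_ h1)[].
apply: negligibleS (negligible_bigcup neg) => x /= /not_implyP[Dx gx].
move: Dx; rewrite (open_bigcup_obox oD) => -[n nP hx].
by exists n => //; rewrite mem_set.
Qed.

End test.

End fundamental_lemma.

(** * Integration by parts *)

Section compact_support.
Variables (R : realType) (d : nat).
Notation E := 'cV[R]_d.
Notation leb := (lebesgue_cV R d).

Lemma continuous_compact_ubound (f : E -> R) (K : set E) :
  continuous f -> compact K -> exists2 M : R, 0 <= M &
  forall x, K x -> `|f x| <= M.
Proof.
move=> cf cK.
have /compact_bounded : compact (f @` K).
  by apply: continuous_compact => //; exact: continuous_subspaceT.
move=> [M [Mreal hM]]; exists (Num.max 0 (M + 1)); first by rewrite le_max lexx.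
move=> x Kx; apply: (hM (Num.max 0 (M + 1))); last by exists x.
by rewrite lt_max ltrDl ltr01 orbT.
Qed.

Lemma continuous_cbox_integrable (f : E -> R) (a b : E) : continuous f ->
  leb.-integrable (cbox a b) (EFin \o f).
Proof.
move=> cf; have mc := measurable_cbox a b.
apply: measurable_bounded_integrable => //.
- exact: lebesgue_cbox_lty.
- exact: continuous_measurable_cV.
have [M M0 fM] := continuous_compact_ubound cf (@compact_cbox R d a b).
exists M; split; first exact: num_real.
by move=> N MN x abx; apply: le_trans (ltW MN); exact: fM.
Qed.

Lemma integrable_supported (f : E -> R) (a b : E) : continuous f ->
  (forall x, ~ cbox a b x -> f x = 0) ->
  leb.-integrable [set: E] (EFin \o f).
Proof.
move=> cf f0; rewrite (_ : EFin \o f = (EFin \o f) \_ (cbox a b)).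
  apply/(integrable_mkcond (EFin \o f) (measurable_cbox a b)).
  exact: continuous_cbox_integrable.
apply/funext => x; rewrite patchE; case: ifPn => // /negP.
by rewrite inE => /f0 /= ->.
Qed.

Lemma partial_notin (f : E -> R) (K : set E) (j : 'I_d) : closed K ->
  (forall x, ~ K x -> f x = 0) -> forall x, ~ K x -> partial j f x = 0.
Proof.
move=> cK f0 x Kx.
have E0 : \forall y \near x, f y = (cst 0 : E -> R) y.
  have : nbhs x (~` K) by apply: open_nbhs_nbhs; split=> //; exact: closed_openC.
  by apply: filterS => y /f0.
by rewrite /partial (near_eq_derive _ E0) derive_cst.
Qed.

End compact_support.

(** * Slices in the first coordinate and integrals of partial derivatives *)

Section slices.
Variables (R : realType) (n : nat).

(** A shift along a unit vector moves either the first coordinate or the tail only. Hence a partial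
    derivative is the derivative of a slice, with identical difference quotients. *)
Lemma cV_consD (h t : R) (j : 'I_n.+1) (x : 'cV[R]_n) :
  h *: unitv R j + cV_cons (t, x) =
  if unlift ord0 j is Some k then cV_cons (t, h *: unitv R k + x)
  else cV_cons (h + t, x).
Proof.
case: (unliftP ord0 j) => [k|] ->; apply/colP => i; rewrite !mxE andbT;
  case: (unliftP ord0 i) => [l|] ->; rewrite /= ?liftK ?unlift_none ?mxE ?andbT//=.
- by rewrite mulr0 add0r.
- by rewrite mulr0 add0r.
- by rewrite mulr1.
Qed.

Lemma continuous_cV_cons_l (x : 'cV[R]_n) :
  continuous (fun t : R => cV_cons (t, x)).
Proof.
move=> t U /nbhs_cV[e e0 tU]; apply/nbhs_ballP; exists e => // s.
rewrite -ball_normE /= distrC => st; apply: tU => i.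
by case: (unliftP ord0 i) => [k|] ->; rewrite ?cV_consS ?cV_cons0//= subrr normr0.
Qed.

Lemma continuous_cV_cons_r (t : R) :
  continuous (fun x : 'cV[R]_n => cV_cons (t, x)).
Proof.
move=> x U /nbhs_cV[e e0 xU]; apply/nbhs_cV; exists e => // y xy; apply: xU => i.
by case: (unliftP ord0 i) => [k|] ->; rewrite ?cV_consS ?cV_cons0//= subrr normr0.
Qed.

Variable psi : 'cV[R]_n.+1 -> R.

Lemma derivable_slice_r (t : R) (k : 'I_n) (x : 'cV[R]_n) :
  derivable psi (cV_cons (t, x)) (unitv R (lift ord0 k)) ->
  is_derive x (unitv R k) (fun x => psi (cV_cons (t, x)))
    (partial (lift ord0 k) psi (cV_cons (t, x))).
Proof.
rewrite /partial => dpsi.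
have E1 : (fun h : R => h^-1 *: ((psi \o shift (cV_cons (t, x)))
     (h *: unitv R (lift ord0 k)) - psi (cV_cons (t, x)))) =
   (fun h : R => h^-1 *: (((fun x => psi (cV_cons (t, x))) \o shift x)
     (h *: unitv R k) - psi (cV_cons (t, x)))).
  by apply/funext => h /=; rewrite cV_consD liftK.
by apply: DeriveDef; move: dpsi; rewrite /derivable /derive E1.
Qed.

Lemma derivable_slice_l (t : R) (x : 'cV[R]_n) :
  derivable psi (cV_cons (t, x)) (unitv R ord0) ->
  is_derive t (1 : R) (fun t => psi (cV_cons (t, x)))
    (partial ord0 psi (cV_cons (t, x))).
Proof.
rewrite /partial => dpsi.
have E1 : (fun h : R => h^-1 *: ((psi \o shift (cV_cons (t, x)))
     (h *: unitv R ord0) - psi (cV_cons (t, x)))) =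
   (fun h : R => h^-1 *: (((fun t => psi (cV_cons (t, x))) \o shift t)
     (h *: 1) - psi (cV_cons (t, x)))).
  by apply/funext => h /=; rewrite cV_consD unlift_none /GRing.scale/= mulr1.
by apply: DeriveDef; move: dpsi; rewrite /derivable /derive E1.
Qed.

End slices.

Section integral_partial.
Variable R : realType.
Notation leb := (lebesgue_cV R).

Lemma integral_derive_supported (phi dphi : R -> R) (a b : R) :
  (forall t, is_derive t (1 : R) phi (dphi t)) -> continuous dphi ->
  (forall t, ~~ (a <= t <= b) -> phi t = 0) ->
  (\int[lebesgue_measure]_t (dphi t)%:E = 0)%E.
Proof.
move=> dphiE cdphi phi0.
have dphi0 t : ~~ (a <= t <= b) -> dphi t = 0.
  move=> tab; have E0 : \forall s \near t, phi s = (cst 0 : R -> R) s.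
    have : nbhs t (~` `[a, b]%classic).
      apply: open_nbhs_nbhs; split; last by rewrite /= in_itv /=; exact/negP.
      by apply: closed_openC; exact: itv_closed.
    apply: filterS => s /=; rewrite in_itv/= => /negP; exact: phi0.
  have [_ <-] := dphiE t.
  by rewrite (near_eq_derive _ E0) derive_cst.
have phic : continuous phi.
  move=> t; apply/differentiable_continuous/derivable1_diffP.
  by have [] := dphiE t.
(* The endpoints a - 1 and B both lie outside [a, b], where phi vanishes; the maximum keeps a - 1 <
   B even when b < a. *)
pose B := Num.max a b + 1.
have Ba : a < B by rewrite /B ltr_pwDr// le_max lexx.
have Bb : b < B by rewrite /B ltr_pwDr// le_max lexx orbT.
have phia : phi (a - 1) = 0 by apply: phi0; apply/negP => /andP[? _]; lra.
have phiB : phi B = 0 by apply: phi0; rewrite (leNgt B) Bb andbF.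
transitivity (\int[lebesgue_measure]_(t in `[(a - 1)%R, B]) (dphi t)%:E)%E.
  rewrite [RHS]integral_mkcond; congr integral.
  apply/funext => t; rewrite patchE; case: ifPn => // /negP.
  rewrite inE/= in_itv/= => h; rewrite dphi0//; apply: contra_notN h => /andP[h1 h2].
  by apply/andP; split; [lra|apply: le_trans h2 (ltW Bb)].
rewrite (@continuous_FTC2 _ _ phi).
- by rewrite phia phiB subee.
- by lra.
- exact: continuous_subspaceT.
- split; first by move=> t _; have [] := dphiE t.
  + exact/cvg_at_right_filter/phic.
  + exact/cvg_at_left_filter/phic.
- by move=> t _; rewrite derive1E; have [_] := dphiE t.
Qed.

(** Change of variables along [cV_cons], then Fubini. Both orders are kept because the innermost
    integral should run over the variable that is differentiated. *)
Lemma integral_lebesgue_cVS n (f : 'cV[R]_n.+1 -> \bar R) :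
  (leb n.+1).-integrable setT f ->
  (\int[leb n.+1]_x f x =
     \int[lebesgue_measure]_t \int[leb n]_x f (cV_cons (t, x)))%E /\
  (\int[leb n.+1]_x f x =
     \int[leb n]_x \int[lebesgue_measure]_t f (cV_cons (t, x)))%E.
Proof.
move=> /integrableP[mf fi].
have mc := @measurable_cV_cons R n.
have mfc : measurable_fun setT (f \o @cV_cons R n) by exact: measurableT_comp.
have ifc : (lebesgue_measure \x leb n)%E.-integrable setT (f \o @cV_cons R n).
  apply/integrableP; split=> //; apply: le_lt_trans fi.
  rewrite [leRHS](_ : _ = \int[pushforward (lebesgue_measure \x leb n)%E (@cV_cons R n)]_x `|f x|)%E//.
  rewrite ge0_integral_pushforward//.
  exact: measurableT_comp.
have -> : (\int[leb n.+1]_x f x =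
    \int[(lebesgue_measure \x leb n)%E]_z (f \o @cV_cons R n) z)%E.
  rewrite [LHS](_ : _ = \int[pushforward (lebesgue_measure \x leb n)%E (@cV_cons R n)]_x f x)%E//.
  by rewrite integral_pushforward.
by rewrite -{1}integral12_prod_meas1// -integral21_prod_meas1.
Qed.

(** If j is the first coordinate, the inner integral over a line is 0 by the one-dimensional case;
    otherwise the first coordinate is frozen and the induction hypothesis applies to the slice. *)
Lemma integral_partial n (psi : 'cV[R]_n -> R) (j : 'I_n) (a b : 'cV[R]_n) :
  (forall x, derivable psi x (unitv R j)) -> continuous (partial j psi) ->
  (forall x, ~ cbox a b x -> psi x = 0) ->
  (\int[leb n]_x (partial j psi x)%:E = 0)%E.
Proof.
elim: n psi j a b => [|n IHn] psi j a b; first by case: j.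
move=> dpsi cpsi psi0.
have ip : (leb n.+1).-integrable setT (EFin \o partial j psi).
  apply: (@integrable_supported _ _ _ a b) => //.
  by apply: partial_notin psi0; exact: closed_cbox.
have [I1 I2] := integral_lebesgue_cVS ip.
move: dpsi cpsi I1 I2 {ip}; case: (unliftP ord0 j) => [k|] -> dpsi cpsi I1 I2.
  rewrite [LHS]I1; under eq_integral => t _.
    rewrite (_ : (\int[_]_x _)%E = (\int[leb n]_x
        (partial k (fun x => psi (cV_cons (t, x))) x)%:E)%E); last first.
      apply: eq_integral => x _ /=; congr EFin; rewrite [RHS]/partial.
      by have [_ ->] := derivable_slice_r (dpsi (cV_cons (t, x))).
    rewrite (IHn _ _ (\col_i a (lift ord0 i) ord0) (\col_i b (lift ord0 i) ord0)).
    - over.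
    - by move=> x; have [] := derivable_slice_r (dpsi (cV_cons (t, x))).
    - rewrite (_ : partial _ _ = fun x => partial (lift ord0 k) psi (cV_cons (t, x))).
        move=> x; apply: (continuous_comp (@continuous_cV_cons_r R n t x)).
        exact: cpsi.
      apply/funext => x; rewrite [LHS]/partial.
      by have [_ ->] := derivable_slice_r (dpsi (cV_cons (t, x))).
    - move=> x xab; apply: psi0 => /(_ (lift ord0 _)) h; apply: xab => i.
      by have := h i; rewrite cV_consS !mxE.
  by rewrite integral0.
have slice0 x : (\int[lebesgue_measure]_t
    (partial ord0 psi (cV_cons (t, x)))%:E = 0)%E.
  apply: (@integral_derive_supported (fun t => psi (cV_cons (t, x)))
    (fun t => partial ord0 psi (cV_cons (t, x))) (a ord0 ord0) (b ord0 ord0)).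
  - by move=> t; exact: derivable_slice_l.
  - move=> t; apply: (continuous_comp (@continuous_cV_cons_l R n x t)).
    exact: cpsi.
  - move=> t /negP tab; apply: psi0 => /(_ ord0); rewrite cV_cons0/=; exact: tab.
rewrite [LHS]I2; under eq_integral => x _ do rewrite /= slice0.
by rewrite integral0.
Qed.

End integral_partial.

(** * Weak gradients *)

Section Lp_on.
Variables (R : realType) (d : nat).
Notation E := 'cV[R]_d.
Notation leb := (lebesgue_cV R d).
Variable D : set E.
Hypothesis mD : measurable D.

Lemma in_Lp_Lfun (p : \bar R) (f : E -> R) :
  in_Lp p D f <-> f \_ D \in Lfun leb p.
Proof.
rewrite /in_Lp; split.
  move=> [mf nf]; rewrite inE/=; apply/andP; split; rewrite inE//=.
  by apply/(measurable_restrict _ mD measurableT); rewrite setTI.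
rewrite inE => /andP[]; rewrite !inE/= => mf nf; split=> //.
by move/(measurable_restrict _ mD measurableT) : mf; rewrite setTI.
Qed.

Lemma in_Lp2_lin (a : R) (f g : E -> R) : in_Lp 2%:E D f -> in_Lp 2%:E D g ->
  in_Lp 2%:E D (fun x => a * f x + g x).
Proof.
have p1 : (1 <= 2%:E :> \bar R)%E by rewrite lee_fin ler1n.
move=> /in_Lp_Lfun Lf /in_Lp_Lfun Lg; apply/in_Lp_Lfun.
have -> : (fun x => a * f x + g x) \_ D = a *: (f \_ D) + g \_ D.
  apply/funext => x; rewrite -[RHS]/(a * (f \_ D) x + (g \_ D) x) !patchE.
  by case: ifP => // _; rewrite mulr0 addr0.
exact: (Lfun_submod_closed leb p1).2.
Qed.

Lemma in_Lp2_cst0 : in_Lp 2%:E D (cst 0 : E -> R).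
Proof.
have p1 : (1 <= 2%:E :> \bar R)%E by rewrite lee_fin ler1n.
apply/in_Lp_Lfun; rewrite (_ : _ \_ D = 0); first exact: (Lfun_submod_closed leb p1).1.
by apply/funext => x; rewrite patchE; case: ifP.
Qed.

Lemma in_Lp2_mul_integrable (f g : E -> R) : in_Lp 2%:E D f -> in_Lp 2%:E D g ->
  leb.-integrable D (fun x => (f x * g x)%:E).
Proof.
move=> /in_Lp_Lfun Lf /in_Lp_Lfun Lg.
have /Lfun1_integrable := Lfun2_mul_Lfun1 Lf Lg.
move=> h; apply/(integrable_mkcond _ mD); congr integrable: h.
apply/funext => x; rewrite patchE /= !patchE; case: ifP => // _.
by rewrite mul0r.
Qed.

(** Domination by 1 + f^2, where the constant is integrable because D has finite measure. *)
Lemma in_Lp2_integrable (f : E -> R) : (leb D < +oo)%E -> in_Lp 2%:E D f ->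
  leb.-integrable D (EFin \o f).
Proof.
move=> Doo Lf; have [mf _] := Lf.
have i2 := in_Lp2_mul_integrable Lf Lf.
have i1 : leb.-integrable D (EFin \o cst 1).
  by apply: measurable_bounded_integrable => //; exact: bounded_cst.
apply: (@le_integrable _ _ _ leb _ mD _ (EFin \o (cst 1 \+ (fun x => f x * f x)))).
- exact/measurable_EFinP.
- move=> x _ /=; rewrite lee_fin [leRHS]ger0_norm; last first.
    by rewrite addr_ge0// -expr2 sqr_ge0.
  by rewrite ler_norml; apply/andP; split; nra.
- rewrite (_ : EFin \o _ = (EFin \o cst 1) \+ (fun x => (f x * f x)%:E))//.
  exact: integrableD.
Qed.

Lemma in_Lpoo_mul_integrable (f g : E -> R) : in_Lp +oo%E D f ->
  leb.-integrable D (EFin \o g) -> leb.-integrable D (fun x => (f x * g x)%:E).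
Proof.
move=> [mf nf] ig; have [M fM] : exists M : R,
    {ae leb, forall x, `|(f \_ D) x| <= M}.
  move: nf; rewrite /finite_norm unlock /Lnorm; case: ifPn => [_|].
    by move=> /ess_supr_bounded[M hM]; exists M.
  (* The sup norm is defined by cases on whether the whole space has positive measure. If it has
     not, any bound holds almost everywhere. *)
  rewrite -leNgt => l0 _; exists 0; exists setT; split=> //.
  by apply/eqP; rewrite eq_le l0/=.
have mg : measurable_fun D g by apply/measurable_EFinP; exact: measurable_int ig.
apply/integrableP; split.
  by apply/measurable_EFinP; exact: measurable_funM.
apply: (@le_lt_trans _ _ (\int[leb]_(x in D) `|(M * g x)%:E|)%E); last first.
  have /integrableP[_] : leb.-integrable D (fun x => (M * g x)%:E).
    exact: (integrableZl mD M ig).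
  exact.
apply: ae_ge0_le_integral => //.
- by apply/measurableT_comp => //; apply/measurable_EFinP; exact: measurable_funM.
- apply/measurableT_comp => //; apply/measurable_EFinP; apply: measurable_funM => //.
- apply: filterS fM => x hx Dx; move: hx; rewrite patchE mem_set// => hx.
  rewrite !abse_EFin lee_fin !normrM ler_wpM2r//.
  exact: le_trans hx (ler_norm _).
Qed.

End Lp_on.

Lemma integrable_EFinZl d (T : measurableType d) (R : realType)
    (mu : {measure set T -> \bar R}) (D : set T) (a : R) (f : T -> R) :
  measurable D -> mu.-integrable D (fun x => (f x)%:E) ->
  mu.-integrable D (fun x => (a * f x)%:E).
Proof. by move=> mD /(integrableZl mD a). Qed.

(** * Linearity and uniqueness of weak gradients, and their values where the function is affine *)

Section weak_gradients.
Variables (R : realType) (d : nat).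
Notation E := 'cV[R]_d.
Notation leb := (lebesgue_cV R d).

Lemma test_function_bounded (D : set E) (phi : E -> R) : test_function D phi ->
  exists2 M, forall x, `|phi x| <= M & forall j x, `|partial j phi x| <= M.
Proof.
move=> [Cphi cK _]; set K := closure _ in cK.
have K0 x : ~ K x -> phi x = 0.
  move=> Kx; apply/eqP; apply: contrapT => /negP p0; apply: Kx.
  exact: subset_closure.
have dK0 j x : ~ K x -> partial j phi x = 0.
  by apply: partial_notin K0 _; exact: closed_closure.
have [M M0 hM] := continuous_compact_ubound (class_C_continuous (Cphi 0%N)) cK.
have cd j := class_C_continuous (class_CSP (Cphi 1%N) j).2.
have /choice[N hN] : forall j, exists N : R, 0 <= N /\
    forall x, K x -> `|partial j phi x| <= N.
  by move=> j; have [N N0 hN] := continuous_compact_ubound (cd j) cK; exists N.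
have SN : 0 <= \sum_j N j by apply: sumr_ge0 => j _; have [] := hN j.
exists (M + \sum_j N j).
  move=> x; have [Kx|/K0->] := pselect (K x); last by rewrite normr0 addr_ge0.
  by rewrite -[leLHS]addr0 lerD// hM.
move=> j x; have [Kx|/dK0->] := pselect (K x); last by rewrite normr0 addr_ge0.
rewrite -[leLHS]add0r lerD// (bigD1 j)//= -[leLHS]addr0 lerD//.
  by have [_ ->] := hN j.
by apply: sumr_ge0 => i _; have [] := hN i.
Qed.

Lemma compact_sub_cbox (K : set E) : compact K -> exists a b, K `<=` cbox a b.
Proof.
move=> cK.
have /choice[N hN] : forall j, exists N : R, forall x, K x -> `|x j ord0| <= N.
  move=> j.
  have [N _ hN] := continuous_compact_ubound (@continuous_coord R d j) cK.
  by exists N.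
exists (- \col_j N j), (\col_j N j) => x Kx i; rewrite !mxE -ler_norml.
exact: hN.
Qed.

Lemma test_function_sub (D D' : set E) (phi : E -> R) : D `<=` D' ->
  test_function D phi -> test_function D' phi.
Proof. by move=> DD' [? ? h]; split=> //; exact: subset_trans h DD'. Qed.

Lemma test_function_notin (D : set E) (phi : E -> R) : test_function D phi ->
  forall x, ~ D x -> phi x = 0.
Proof.
move=> [_ _ h] x Dx; apply/eqP; apply: contrapT => /negP p0; apply: Dx; apply: h.
exact: subset_closure.
Qed.

Lemma test_function_partial_notin (D : set E) (phi : E -> R) j :
  test_function D phi -> forall x, ~ D x -> partial j phi x = 0.
Proof.
move=> [Cphi _ h] x Dx.
apply: (@partial_notin _ _ phi (closure [set x | phi x != 0])).
- exact: closed_closure.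
- move=> y Ky; apply/eqP; apply: contrapT => /negP p0; apply: Ky.
  exact: subset_closure.
- by move=> Kx; apply: Dx; exact: h.
Qed.

Section on_Omega.
Variable Omega : set E.
Hypothesis oOmega : open Omega.
Hypothesis Omegaoo : (leb Omega < +oo)%E.
Let mOmega : measurable Omega := open_measurable_cV oOmega.

Lemma integrable_mul_bounded (f h : E -> R) (M : R) :
  in_Lp 2%:E Omega f -> continuous h -> (forall x, `|h x| <= M) ->
  leb.-integrable Omega (fun x => (f x * h x)%:E).
Proof.
move=> Lf ch hM; have := @integrableMl _ _ _ leb _ mOmega (EFin \o f) h.
apply.
- exact: in_Lp2_integrable.
- exact: continuous_measurable_cV.
- exists M; split; first exact: num_real.
  by move=> N MN x _; apply: le_trans (ltW MN).
Qed.

Lemma integrable_mul_test (f phi : E -> R) : in_Lp 2%:E Omega f ->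
  test_function Omega phi -> leb.-integrable Omega (fun x => (f x * phi x)%:E).
Proof.
move=> Lf tphi; have [M hM _] := test_function_bounded tphi.
apply: integrable_mul_bounded hM => //.
by have [Cphi _ _] := tphi; exact: (class_C_continuous (Cphi 0%N)).
Qed.

Lemma integrable_mul_partial (f phi : E -> R) j : in_Lp 2%:E Omega f ->
  test_function Omega phi ->
  leb.-integrable Omega (fun x => (f x * partial j phi x)%:E).
Proof.
move=> Lf tphi; have [M _ hM] := test_function_bounded tphi.
apply: integrable_mul_bounded (hM j) => //.
by have [Cphi _ _] := tphi; exact: (class_C_continuous (class_CSP (Cphi 1%N) j).2).
Qed.

(** Splitting the integrals requires integrable terms: a square-integrable function is integrable on
    Omega, of finite measure, and test functions and their partial derivatives are bounded. *)
Lemma weak_gradient_lin (a : R) (v w : E -> R) (g h : E -> E) :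
  in_Lp 2%:E Omega v -> in_Lp 2%:E Omega w ->
  weak_gradient Omega v g -> weak_gradient Omega w h ->
  weak_gradient Omega (fun x => a * v x + w x) (fun x => a *: g x + h x).
Proof.
move=> Lv Lw [Lg vg] [Lh wh]; split.
  move=> j; rewrite (_ : (fun x => _) = (fun x => a * g x j ord0 + h x j ord0)).
    exact: in_Lp2_lin.
  by apply/funext => x; rewrite !mxE.
move=> phi tphi j.
under eq_Rintegral do rewrite mulrDl -mulrA.
rewrite RintegralD//; last 2 first.
- apply: integrable_EFinZl => //; exact: integrable_mul_partial.
- exact: integrable_mul_partial.
rewrite RintegralZl//; last exact: integrable_mul_partial.
under [in RHS]eq_Rintegral do rewrite !mxE mulrDl -mulrA.
rewrite RintegralD//; last 2 first.
- apply: integrable_EFinZl => //; exact: (integrable_mul_test (Lg j)).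
- exact: (integrable_mul_test (Lh j)).
rewrite RintegralZl//; last exact: (integrable_mul_test (Lg j)).
by rewrite vg// wh// mulrN opprD.
Qed.

Lemma weak_gradient_cst0 : weak_gradient Omega (cst 0) (cst 0).
Proof.
split.
  move=> j; rewrite (_ : (fun x => _) = cst 0); first exact: in_Lp2_cst0.
  by apply/funext => x; rewrite mxE.
move=> phi tphi j; under eq_Rintegral do rewrite mul0r.
under [in RHS]eq_Rintegral do rewrite mxE mul0r.
by rewrite Rintegral_cst// mul0r oppr0.
Qed.

Lemma weak_gradient_sum (I : Type) (r : seq I) (c : I -> R) (v : I -> E -> R)
    (g : I -> E -> E) :
  (forall i, in_Lp 2%:E Omega (v i)) ->
  (forall i, weak_gradient Omega (v i) (g i)) ->
  in_Lp 2%:E Omega (fun x => \sum_(i <- r) c i * v i x) /\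
  weak_gradient Omega (fun x => \sum_(i <- r) c i * v i x)
    (fun x => \sum_(i <- r) c i *: g i x).
Proof.
move=> Lv vg; elim: r => [|i r [IH1 IH2]].
  under eq_fun do rewrite big_nil; under [X in weak_gradient _ _ X]eq_fun do rewrite big_nil.
  by split; [exact: in_Lp2_cst0|exact: weak_gradient_cst0].
under eq_fun do rewrite big_cons; under [X in weak_gradient _ _ X]eq_fun do rewrite big_cons.
by split; [exact: in_Lp2_lin|exact: weak_gradient_lin].
Qed.

Lemma weak_gradient_unique (v : E -> R) (g h : E -> E) :
  weak_gradient Omega v g -> weak_gradient Omega v h ->
  {ae leb, forall x, Omega x -> g x = h x}.
Proof.
move=> [Lg vg] [Lh vh].
have gh j : ae_eq leb Omega (fun x => g x j ord0 - h x j ord0) (cst 0).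
  have Lgh : in_Lp 2%:E Omega (fun x => g x j ord0 - h x j ord0).
    rewrite (_ : (fun x => _) = (fun x => -1 * h x j ord0 + g x j ord0)).
      exact: in_Lp2_lin.
    by apply/funext => x; rewrite mulN1r addrC.
  apply: test_function_ae_eq0 => //.
  - by have [] := Lgh.
  - move=> a b abO; apply: integrableS (in_Lp2_integrable mOmega Omegaoo Lgh) => //.
    exact: measurable_cbox.
  - move=> phi tphi; under eq_Rintegral do rewrite mulrBl.
    rewrite RintegralB//; last 2 first.
    + exact: (integrable_mul_test (Lg j)).
    + exact: (integrable_mul_test (Lh j)).
    by apply/eqP; rewrite subr_eq0 -eqr_opp -vg// -vh.
have : {ae leb, forall x, forall j : 'I_d, Omega x -> g x j ord0 - h x j ord0 = 0}.
  by apply: (@filter_forall _ _ (fun j => [set x | Omega x -> g x j ord0 - h x j ord0 = 0])) => j; exact: gh.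
apply: filterS => x hx Ox; apply/colP => j.
by apply/eqP; rewrite -subr_eq0 hx.
Qed.

End on_Omega.

Lemma dotDr (b x y : E) : dot b (x + y) = dot b x + dot b y.
Proof. by rewrite /dot -big_split/=; apply: eq_bigr => i _; rewrite mxE mulrDr. Qed.

Lemma dotZr (t : R) (b x : E) : dot b (t *: x) = t * dot b x.
Proof. by rewrite /dot mulr_sumr; apply: eq_bigr => i _; rewrite mxE mulrCA. Qed.

Lemma dot_unitv (b : E) j : dot b (unitv R j) = b j ord0.
Proof.
rewrite /dot (bigD1 j)//= big1 ?addr0 ?mxE ?eqxx ?mulr1//.
by move=> i ij; rewrite mxE (negbTE ij) mulr0.
Qed.

Lemma is_derive_affine (c : R) (b : E) j (x : E) :
  is_derive x (unitv R j) (fun x => c + dot b x) (b j ord0).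
Proof.
have [hd hv] : is_derive (0 : R) (1 : R) (fun t => b j ord0 * t) (b j ord0).
  have := is_deriveZ (b j ord0) (is_derive_id (0 : R) (1 : R)).
  by rewrite /GRing.scale/= mulr1.
have E1 : (fun t : R => t^-1 *: (((fun x => c + dot b x) \o shift x)
    (t *: unitv R j) - (c + dot b x))) =
  (fun t : R => t^-1 *: (((fun t => b j ord0 * t) \o shift 0) (t *: 1) - b j ord0 * 0)).
  apply/funext => t /=; congr (_ *: _).
  by rewrite dotDr dotZr dot_unitv /GRing.scale/=; ring.
by apply: DeriveDef; rewrite ?/derivable ?/derive E1.
Qed.

Lemma derivable_affine (c : R) (b : E) j (x : E) :
  derivable (fun x => c + dot b x) x (unitv R j).
Proof. by have [] := is_derive_affine c b j x. Qed.

Lemma continuous_affine (c : R) (b : E) : continuous (fun x : E => c + dot b x).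
Proof.
move=> x.
suff h : (fun y : E => dot b y) @ x --> dot b x by exact: (cvgD (cvg_cst c) h).
rewrite /dot; elim: (index_enum _) => [|i r IHr].
  rewrite big_nil (_ : (fun y : E => _) = cst 0); first exact: (@cst_continuous E R 0 x).
  by apply/funext => y; rewrite big_nil.
rewrite big_cons (_ : (fun y : E => _) = (fun y : E =>
  b i ord0 * y i ord0 + \sum_(j <- r) b j ord0 * y j ord0)); last first.
  by apply/funext => y; rewrite big_cons.
exact: (cvgD (cvgMr (a:=b i ord0) (@continuous_coord R d i x)) IHr).
Qed.

(** The product of the affine function and phi has compact support, so its partial derivative has
    integral 0; the product rule then gives the formula. *)
Lemma integral_affine_partial (D : set E) (phi : E -> R) (c : R) (b : E) j :
  test_function D phi ->
  \int[leb]_x ((c + dot b x) * partial j phi x) = - (b j ord0 * \int[leb]_x phi x).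
Proof.
move=> [Cphi cK _]; have [l [r Klr]] := compact_sub_cbox cK.
have phi0 x : ~ cbox l r x -> phi x = 0.
  move=> lrx; apply/eqP; apply: contrapT => /negP p0; apply: lrx; apply: Klr.
  exact: subset_closure.
have dphi0 i := partial_notin i (@closed_cbox _ _ l r) phi0.
have cphi := class_C_continuous (Cphi 0%N).
have [dphi /class_C_continuous cdphi] := class_CSP (Cphi 1%N) j.
pose psi x := (c + dot b x) * phi x.
have dpsiE : partial j psi =
    (fun x => (c + dot b x) * partial j phi x + b j ord0 * phi x).
  apply/funext => x; rewrite partialM//; last exact: derivable_affine.
  rewrite addrC; congr (_ + _ * _).
  by have [_] := is_derive_affine c b j x.
have c1 : continuous (fun x => (c + dot b x) * partial j phi x).
  by move=> x; exact: (cvgM (@continuous_affine c b x) (cdphi x)).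
have c2 : continuous (fun x => b j ord0 * phi x).
  by move=> x; exact: (cvgMr (a:=b j ord0) (cphi x)).
have i0 := integrable_supported cphi phi0.
have i1 := integrable_supported c1 (fun x h =>
  eq_trans (congr1 _ (dphi0 j x h)) (mulr0 _)).
have i2 := integrable_EFinZl (b j ord0) measurableT i0.
have cpsi : continuous (partial j psi).
  by rewrite dpsiE => x; exact: (cvgD (c1 x) (c2 x)).
have dpsi x : derivable psi x (unitv R j).
  by apply: derivableM => //; exact: derivable_affine.
have psi0 x : ~ cbox l r x -> psi x = 0.
  by move=> /phi0; rewrite /psi => ->; rewrite mulr0.
have : \int[leb]_x (partial j psi x) = 0.
  by rewrite /Rintegral (integral_partial dpsi cpsi psi0).
rewrite dpsiE RintegralD// RintegralZl// => /eqP; rewrite addr_eq0 => /eqP.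
exact.
Qed.

(** A test function on D is one on Omega. As it and its derivatives vanish off D, v may be replaced
    by its affine expression on the whole space, and g - b integrates to 0 against every test
    function on D. *)
Lemma weak_gradient_affine (Omega D : set E) (v : E -> R) (g : E -> E) (b : E) :
  open Omega -> (leb Omega < +oo)%E -> open D -> D `<=` Omega ->
  weak_gradient Omega v g -> affine_on D v b ->
  {ae leb, forall x, D x -> g x = b}.
Proof.
move=> oO Ooo oD DO [Lg vg] [c vE].
have mO := open_measurable_cV oO; have mD := open_measurable_cV oD.
have Doo : (leb D < +oo)%E.
  by apply: le_lt_trans Ooo; apply: le_measure; rewrite ?inE.
have gb j : ae_eq leb D (fun x => g x j ord0 - b j ord0) (cst 0).
  have igD : leb.-integrable D (fun x => (g x j ord0)%:E).
    exact: (integrableS mO mD DO (in_Lp2_integrable mO Ooo (Lg j))).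
  have icD : leb.-integrable D (fun=> (b j ord0)%:E).
    apply: (@measurable_bounded_integrable _ _ _ leb (cst (b j ord0))) => //.
    exact: bounded_cst.
  have igb : leb.-integrable D (fun x => (g x j ord0 - b j ord0)%:E).
    exact: (integrableB mD igD icD).
  apply: test_function_ae_eq0 => //.
  - by apply/measurable_EFinP; exact: measurable_int igb.
  - move=> l r lrD; apply: integrableS igb => //; exact: measurable_cbox.
  move=> phi tphi; have tphi' := test_function_sub DO tphi.
  have [M phiM _] := test_function_bounded tphi.
  have cphi : continuous phi.
    by have [Cphi _ _] := tphi; exact: (class_C_continuous (Cphi 0%N)).
  have iphi : leb.-integrable D (EFin \o phi).
    apply: measurable_bounded_integrable => //; first exact: continuous_measurable_cV.
    exists M; split; first exact: num_real.
    by move=> N MN x _; apply: le_trans (ltW MN).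
  have igphi : leb.-integrable D (fun x => (g x j ord0 * phi x)%:E).
    exact: (integrableS mO mD DO (integrable_mul_test oO Ooo (Lg j) tphi')).
  under eq_Rintegral do rewrite mulrBl.
  rewrite RintegralB//; last exact: (integrable_EFinZl (b j ord0) mD iphi).
  rewrite RintegralZl//.
  have -> : \int[leb]_(x in D) (g x j ord0 * phi x) =
      \int[leb]_(x in Omega) (g x j ord0 * phi x).
    rewrite Rintegral_mkcond [RHS]Rintegral_mkcond; congr Rintegral.
    apply/funext => x; rewrite !patchE.
    case: (pselect (D x)) => Dx.
      by rewrite !mem_set//; exact: DO.
    rewrite (memNset Dx); case: ifP => // _.
    by rewrite (test_function_notin tphi) ?mulr0.
  have -> : \int[leb]_(x in D) phi x = \int[leb]_x phi x.
    rewrite Rintegral_mkcond; congr Rintegral.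
    apply/funext => x; rewrite patchE; case: ifP => // /negP; rewrite inE.
    by move=> /(test_function_notin tphi).
  apply/eqP; rewrite subr_eq0 -eqr_opp -vg//.
  rewrite -(integral_affine_partial c b j tphi); apply/eqP.
  rewrite Rintegral_mkcond; congr Rintegral; apply/funext => x; rewrite patchE.
  case: (pselect (D x)) => Dx.
    by rewrite mem_set ?vE//; exact: DO.
  by rewrite (test_function_partial_notin j tphi)// !mulr0; case: ifP.
have : {ae leb, forall x, forall j : 'I_d, D x -> g x j ord0 - b j ord0 = 0}.
  by apply: (@filter_forall _ _ (fun j => [set x | D x -> g x j ord0 - b j ord0 = 0])) => j; exact: gb.
apply: filterS => x hx Dx; apply/colP => j.
by apply/eqP; rewrite -subr_eq0 hx.
Qed.

End weak_gradients.

(** * Simplices, meshes and Lipschitz domains *)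

Section affine.
Variables (R : realType) (d : nat).
Notation E := 'cV[R]_d.

Lemma dot_sumr (I : Type) (r : seq I) (b : E) (x : I -> E) :
  dot b (\sum_(i <- r) x i) = \sum_(i <- r) dot b (x i).
Proof.
elim: r => [|i r IHr]; last by rewrite !big_cons dotDr IHr.
by rewrite !big_nil /dot big1// => i _; rewrite mxE mulr0.
Qed.

Lemma affine_comb n (lam : 'I_n -> R) (q : 'I_n -> E) (c : R) (b : E) :
  \sum_i lam i = 1 ->
  c + dot b (\sum_i lam i *: q i) = \sum_i lam i * (c + dot b (q i)).
Proof.
move=> lam1; under [RHS]eq_bigr do rewrite mulrDr -dotZr.
by rewrite big_split/= -mulr_suml lam1 mul1r dot_sumr.
Qed.

Lemma dotC (x y : E) : dot x y = dot y x.
Proof. by apply: eq_bigr => i _; rewrite mulrC. Qed.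

Lemma dotNl (b x : E) : dot (- b) x = - dot b x.
Proof. by rewrite -scaleN1r dotC dotZr mulN1r dotC. Qed.

Lemma dot_suml (I : Type) (r : seq I) (b : I -> E) (x : E) :
  dot (\sum_(i <- r) b i) x = \sum_(i <- r) dot (b i) x.
Proof. by rewrite dotC dot_sumr; apply: eq_bigr => i _; rewrite dotC. Qed.

End affine.

(** * Barycentric coordinates of a simplex *)

Section simplex.
Variables (R : realType) (d : nat).
Notation E := 'cV[R]_d.
Notation leb := (lebesgue_cV R d).
Variable p : 'I_d.+1 -> E.

Definition edge_mx : 'M[R]_d :=
  \matrix_(i < d, j < d) (p (lift ord0 j) - p ord0) i ord0.

Hypothesis edge_unit : edge_mx \in unitmx.

(* bary k x is the k-th barycentric coordinate of x, an affine function with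
   gradient bary_grad k. *)
Definition bary_grad (k : 'I_d.+1) : E :=
  let b j := (row j (invmx edge_mx))^T in
  if unlift ord0 k is Some j then b j else - \sum_j b j.

Definition bary (k : 'I_d.+1) (x : E) : R :=
  (k == ord0)%:R - dot (bary_grad k) (p ord0) + dot (bary_grad k) x.

Lemma bary_lift j x :
  bary (lift ord0 j) x = (invmx edge_mx *m (x - p ord0)) j ord0.
Proof.
rewrite /bary /bary_grad liftK eq_sym eq_liftF sub0r addrC.
rewrite -mulN1r -dotZr -dotDr scaleN1r mxE.
by apply: eq_bigr => i _; rewrite !mxE.
Qed.

Lemma bary_ord0 x : bary ord0 x = 1 - \sum_j bary (lift ord0 j) x.
Proof.
rewrite /bary /bary_grad unlift_none eqxx !dotNl !dot_suml.
under [in RHS]eq_bigr do rewrite liftK eq_sym eq_liftF sub0r.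
by rewrite big_split/= sumrN opprD opprK addrA.
Qed.

Lemma bary_sum1 x : \sum_k bary k x = 1.
Proof. by rewrite big_ord_recl bary_ord0 subrK. Qed.

Lemma bary_comb x : x = \sum_k bary k x *: p k.
Proof.
rewrite big_ord_recl bary_ord0 scalerBl scale1r scaler_suml addrAC -addrA -sumrB.
under eq_bigr do rewrite -scalerBr bary_lift.
set y := invmx edge_mx *m (x - p ord0).
have -> : \sum_i y i ord0 *: (p (lift ord0 i) - p ord0) = edge_mx *m y.
  apply/colP => l; rewrite summxE mxE; apply: eq_bigr => i _.
  by rewrite mxE [in RHS]mxE mulrC.
by rewrite /y mulKVmx// addrC subrK.
Qed.

Lemma bary_vertex k l : bary k (p l) = (k == l)%:R.
Proof.
have lift_vertex j : bary (lift ord0 j) (p l) = (lift ord0 j == l)%:R.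
  rewrite bary_lift; case: (unliftP ord0 l) => [m|] ->; last first.
    by rewrite subrr mulmx0 mxE eq_sym eq_liftF.
  have -> : p (lift ord0 m) - p ord0 = col m edge_mx.
    by apply/colP => i; rewrite [RHS]mxE [RHS]mxE.
  by rewrite colE mulmxA mulVmx// mul1mx mxE andbT (inj_eq lift_inj).
case: (unliftP ord0 k) => [j|] -> //.
rewrite bary_ord0; under eq_bigr do rewrite lift_vertex.
case: (unliftP ord0 l) => [m|] ->.
  rewrite (bigD1 m)//= eqxx big1 ?addr0 ?subrr ?eq_liftF//.
  by move=> i im; rewrite (inj_eq lift_inj) (negbTE im).
by rewrite big1 ?subr0 ?eqxx.
Qed.

Lemma bary_affine n (lam : 'I_n -> R) (q : 'I_n -> E) k : \sum_i lam i = 1 ->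
  bary k (\sum_i lam i *: q i) = \sum_i lam i * bary k (q i).
Proof. exact: affine_comb. Qed.

Lemma continuous_bary k : continuous (bary k).
Proof. exact: continuous_affine. Qed.

(** Barycentric coordinates are affine and are Kronecker symbols at the vertices, so any convex
    combination of vertices, of any length and with repetitions, has nonnegative ones. *)
Lemma hull_bary x : hull (range p) x <-> forall k, 0 <= bary k x.
Proof.
split=> [[n [q [lam [qp lam0 lam1 ->]]]] k|x0].
  rewrite bary_affine//; apply: sumr_ge0 => i _; rewrite mulr_ge0//.
  by have [l _ <-] := qp i; rewrite bary_vertex.
exists d.+1, p, (bary^~ x); split=> //.
- exact: bary_sum1.
- exact: bary_comb.
Qed.

(** Puts a face that misses vertex k into the plane of the opposite facet; this is how conformity of
    a mesh yields null overlaps. *)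
Lemma hull_face k (S : set E) x : S `<=` range p -> ~ S (p k) -> hull S x ->
  bary k x = 0.
Proof.
move=> Sp Sk [n [q [lam [qS _ lam1 ->]]]].
rewrite bary_affine// big1// => i _.
have [l _ ql] := Sp _ (qS i); rewrite -ql bary_vertex.
case: eqP => [kl|_]; last by rewrite mulr0.
by case: Sk; rewrite kl ql.
Qed.

Lemma measurable_bary0 k : measurable [set x | bary k x = 0].
Proof. exact: measurable_hyperplane. Qed.

Lemma lebesgue_bary0 k : leb [set x | bary k x = 0] = 0%E.
Proof.
(* A zero gradient, as in dimension 0, makes [bary k] constant and equal to its value 1 at vertex k,
   so the set is empty. *)
have [b0|b0] := eqVneq (bary_grad k) 0; last exact: lebesgue_hyperplane.
rewrite (_ : [set _ | _] = set0) ?measure0//; apply/seteqP; split=> x //=.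
have := bary_vertex k k; rewrite eqxx /bary b0 => /eqP.
have dot0 y : dot (0 : E) y = 0.
  by rewrite /dot big1// => i _; rewrite mxE mul0r.
by rewrite !dot0 => /eqP -> /eqP; rewrite oner_eq0.
Qed.

Definition open_simplex : set E := [set x | forall k, 0 < bary k x].

Lemma open_open_simplex : open open_simplex.
Proof.
rewrite openE => x x0.
apply: (@filter_forall _ _ (fun k => [set y | 0 < bary k y]) (nbhs x)) => k.
suff : open (bary k @^-1` [set t | 0 < t]) by move=> ok; apply: open_nbhs_nbhs; split=> //; exact: x0.
by apply: open_comp; [move=> y _; exact: continuous_bary|exact: open_gt].
Qed.

Lemma open_simplex_nonempty : open_simplex !=set0.
Proof.
(* The witness is the barycentre. *)
pose lam (i : 'I_d.+1) : R := d.+1%:R^-1.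
have lam1 : \sum_i lam i = 1.
  by rewrite /lam sumr_const card_ord -[LHS]mulr_natr mulVf // pnatr_eq0.
exists (\sum_i lam i *: p i) => k; rewrite bary_affine//.
rewrite (bigD1 k)//= big1 ?addr0 ?bary_vertex ?eqxx ?mulr1 ?invr_gt0//.
by move=> i ik; rewrite bary_vertex eq_sym (negbTE ik) mulr0.
Qed.

Lemma open_simplex_interior : open_simplex `<=` (hull (range p))°.
Proof.
move=> x x0; have := open_nbhs_nbhs (conj open_open_simplex x0).
by apply: filterS => y y0; apply/hull_bary => k; rewrite ltW.
Qed.

Lemma closed_simplex : closed (hull (range p)).
Proof.
rewrite (_ : hull (range p) =
    \bigcap_(k in [set: 'I_d.+1]) (bary k @^-1` [set t | 0 <= t])); last first.
  apply/seteqP; split=> x; first by move/hull_bary => h k _; exact: h.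
  by move=> h; apply/hull_bary => k; exact: h.
apply: closed_bigI => k _; apply: preimage_closed; last exact: closed_ge.
by move=> x _; exact: continuous_bary.
Qed.

Lemma simplex_coord_le x i : hull (range p) x ->
  `|x i ord0| <= \sum_k `|p k i ord0|.
Proof.
move=> /hull_bary x0; rewrite {1}(bary_comb x) summxE.
apply: le_trans (ler_norm_sum _ _ _) _; apply: ler_sum => k _.
rewrite mxE normrM ler_piMl// ger0_norm// -(bary_sum1 x).
by rewrite (bigD1 k)//= lerDl sumr_ge0.
Qed.

Lemma lebesgue_simplex_gt0 : (0 < leb (hull (range p)))%E.
Proof.
apply: (lt_le_trans (lebesgue_open_gt0 open_open_simplex open_simplex_nonempty)).
apply: le_measure; rewrite ?inE.
- by apply: open_measurable_cV; exact: open_open_simplex.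
- by apply: closed_measurable_cV; exact: closed_simplex.
- by move=> x x0; apply/hull_bary => k; rewrite ltW.
Qed.

Lemma lebesgue_simplex_lty : (leb (hull (range p)) < +oo)%E.
Proof.
pose r : E := \col_i \sum_k `|p k i ord0|.
apply: le_lt_trans (lebesgue_cbox_lty (- r) r); apply: le_measure; rewrite ?inE.
- by apply: closed_measurable_cV; exact: closed_simplex.
- exact: measurable_cbox.
- by move=> x hx i; rewrite !mxE -ler_norml simplex_coord_le.
Qed.

End simplex.

(** * Lipschitz domains and the interior of their closure *)

Section lipschitz.
Variables (R : realType) (d : nat).
Notation E := 'cV[R]_d.

Lemma dot_ge0 (x : E) : 0 <= dot x x.
Proof. by apply: sumr_ge0 => i _; rewrite -expr2 sqr_ge0. Qed.

Lemma enorm_sqr (x : E) : enorm x ^+ 2 = dot x x.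
Proof. by rewrite sqr_sqrtr// dot_ge0. Qed.

Lemma enorm_ge0 (x : E) : 0 <= enorm x.
Proof. exact: sqrtr_ge0. Qed.

Section projection.
Variable e : E.
Hypothesis e1 : enorm e = 1.

Lemma dot_proj (x : E) : dot (x - dot x e *: e) (x - dot x e *: e) =
  dot x x - dot x e ^+ 2.
Proof.
have ee : dot e e = 1 by rewrite -enorm_sqr e1 expr1n.
rewrite -scaleNr dotDr dotZr dotC dotDr dotZr [dot (_ + _) e]dotC dotDr dotZr ee.
by rewrite (dotC e x); ring.
Qed.

Lemma enorm_proj (x : E) : enorm (x - dot x e *: e) <= enorm x.
Proof. by rewrite ler_wsqrtr// dot_proj lerBlDr lerDl sqr_ge0. Qed.

Lemma dot_le_enorm (x : E) : dot x e <= enorm x.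
Proof.
have := dot_ge0 (x - dot x e *: e); rewrite dot_proj subr_ge0 -enorm_sqr.
have := enorm_ge0 x; nra.
Qed.

End projection.

Lemma nbhs_enorm (z : E) (r : R) : 0 < r -> nbhs z [set x | enorm (x - z) < r].
Proof.
(* In a cube of half-width r/(d+1) the squared Euclidean distance is at most d r^2/(d+1)^2 < r^2;
   d+1 avoids division by 0. *)
move=> r0; apply/nbhs_cV; exists (r / d.+1%:R); first by rewrite divr_gt0.
move=> y yz /=; rewrite -(@ltr_pXn2r _ 2)// ?nnegrE ?enorm_ge0 ?ltW//.
rewrite enorm_sqr; apply: (@le_lt_trans _ _ (d%:R * (r / d.+1%:R) ^+ 2)).
  rewrite (_ : d%:R * _ = \sum_(i < d) (r / d.+1%:R) ^+ 2); last first.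
    by rewrite sumr_const card_ord mulr_natl.
  apply: ler_sum => i _.
  rewrite -expr2 -real_normK ?num_real// lerXn2r ?nnegrE//.
    by rewrite divr_ge0// ltW.
  by have := yz i; rewrite !mxE => /ltW.
rewrite expr_div_n mulrCA gtr_pMr ?exprn_gt0// ltr_pdivrMr ?exprn_gt0// mul1r.
by rewrite -natrX ltr_nat; exact: (@leq_pexp2l d.+1 1 2).
Qed.

(** A point z of the interior of the closure outside Omega lies on or below the graph of [gamma].
    Then z - t e, for small t > 0, is at depth at least t below it, yet is a limit of points of
    Omega, which lie strictly above the graph; the Lipschitz bound rules this out. *)
Lemma lipschitz_interior_closure (Omega : set E) : lipschitz_boundary Omega ->
  (closure Omega)° `<=` Omega.
Proof.
move=> lipO z zcl; apply: contrapT => Oz.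
have [e [gamma [L [r [e1 r0 Lip epi]]]]] :=
  lipO z (interior_subset zcl) Oz.
have ee : dot e e = 1 by rewrite -enorm_sqr e1 expr1n.
pose P (x : E) := x - dot x e *: e.
have Pe x : dot (P x) e = 0.
  by rewrite /P -scaleNr dotC dotDr dotZr ee mulr1 (dotC e) subrr.
have gz : dot z e <= gamma (P z).
  rewrite leNgt; apply/negP => h; apply: Oz; apply/(epi z) => //.
  rewrite subrr /enorm (_ : dot 0 0 = 0) ?sqrtr0//.
  by rewrite /dot big1// => i _; rewrite mxE mul0r.
have [s s0 hs] : exists2 s : R, 0 < s &
    forall t, 0 <= t <= s -> closure Omega (z - t *: e).
  move/nbhs_cV: zcl => [s s0 hs]; exists (s / 2); first by rewrite divr_gt0.
  move=> t /andP[t0 ts]; apply: hs => i; rewrite !mxE addrAC subrr add0r normrN.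
  rewrite normrM (ger0_norm t0).
  have ei : `|e i ord0| <= 1.
    rewrite -(@ler_pXn2r _ 2)// ?nnegrE// expr1n real_normK ?num_real//.
    rewrite -ee /dot (bigD1 i)//= -expr2 lerDl sumr_ge0// => j _.
    by rewrite -expr2 sqr_ge0.
  apply: (@le_lt_trans _ _ (s / 2)); last by lra.
  by have := normr_ge0 (e i ord0); nra.
(* t <= s keeps z - t e in the closure; t <= r/2 together with del <= t/2 keeps the approximating
   point y within r of z, since t + del <= 3r/4. *)
pose t := Num.min s (r / 2).
have t0 : 0 < t by rewrite lt_min s0 divr_gt0.
have ts : 0 <= t <= s by rewrite ltW// ge_min lexx.
have tr : t <= r / 2 by rewrite ge_min lexx orbT.
(* Moving by w changes the height by at most |w| and the graph by at most |L| |w|; (|L| + 1) del <=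
   t/2 makes both too small to compensate the descent t. The absolute value is there because L
   carries no sign condition. *)
pose del := Num.min (t / (2 * (`|L| + 1))) (t / 2).
have L0 := normr_ge0 L.
have del0 : 0 < del.
  by rewrite lt_min; apply/andP; split; apply: divr_gt0 => //; lra.
have [y [Oy /= ydel]] := hs t ts _ (nbhs_enorm (z - t *: e) del0).
set w := y - (z - t *: e) in ydel.
have yE : y = z + w - t *: e by apply/colP => i; rewrite /w !mxE; ring.
clearbody w.
have wdel : dot w e <= enorm w := dot_le_enorm e1 w.
have dt : del <= t / 2 by rewrite ge_min lexx orbT.
have dL : (`|L| + 1) * del <= t / 2.
  have : del <= t / (2 * (`|L| + 1)) by rewrite ge_min lexx.
  rewrite ler_pdivlMr; last lra.
  by move=> h; lra.
have yr : enorm (y - z) < r.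
  have -> : y - z = w - t *: e by apply/colP => i; rewrite yE !mxE; ring.
  have w0 := enorm_ge0 w.
  rewrite -(@ltr_pXn2r _ 2)// ?nnegrE ?enorm_ge0 ?ltW//.
  rewrite enorm_sqr -scaleNr dotDr dotZr dotC dotDr dotZr [dot (_ + _) e]dotC.
  rewrite dotDr dotZr ee -enorm_sqr (dotC e w).
  have : - dot w e <= enorm w.
    have := dot_le_enorm e1 (- w).
    by rewrite /enorm !dotNl (dotC w (- w)) dotNl opprK.
  by move=> h; nra.
have := (epi y yr).1 Oy; rewrite -/(P y).
have ye : dot y e = dot z e + dot w e - t.
  by rewrite yE dotC !dotDr -scaleNr dotZr ee mulr1 !(dotC e).
have Pyz : P y - P z = P w.
  by rewrite /P ye; apply/colP => i; rewrite yE !mxE; ring.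
have := Lip _ _ (Pe y) (Pe z); rewrite Pyz ler_norml => /andP[h1 _].
have Pw : enorm (P w) <= enorm w by exact: enorm_proj.
have LL : L * enorm (P w) <= `|L| * enorm w.
  apply: (@le_trans _ _ (`|L| * enorm (P w))).
    by rewrite ler_wpM2r ?enorm_ge0 ?ler_norm.
  by rewrite ler_wpM2l.
have Lw : `|L| * enorm w <= `|L| * del by rewrite ler_wpM2l// ltW.
rewrite ye; lra.
Qed.

End lipschitz.

(** * Cells of a mesh up to a null set *)

Section mesh.
Variables (R : realType) (d : nat).
Notation E := 'cV[R]_d.
Notation leb := (lebesgue_cV R d).
Variables (Omega : set E) (M : mesh R d).
Hypothesis hM : regular_triangulation Omega M.

Lemma cell_unitmx (T : 'I_(ncells M)) : edge_mx (vertex T) \in unitmx.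
Proof. by have [h _ _ _] := hM; exact: h. Qed.

Lemma measurable_cell (T : 'I_(ncells M)) : measurable (cell T).
Proof.
exact: (closed_measurable_cV (closed_simplex (cell_unitmx T))).
Qed.

Lemma cell_vol_gt0 (T : 'I_(ncells M)) : 0 < vol (cell T).
Proof.
by rewrite fine_gt0// (lebesgue_simplex_gt0 (cell_unitmx T))
  (lebesgue_simplex_lty (cell_unitmx T)).
Qed.

Lemma cell_sub_closure (T : 'I_(ncells M)) : cell T `<=` closure Omega.
Proof. by have [_ _ _ <-] := hM; move=> x Tx; exists T. Qed.

Lemma lebesgue_domain_lty : open Omega -> (leb Omega < +oo)%E.
Proof.
move=> oO.
pose r : E := \col_i \sum_(T < ncells M) \sum_k `|vertex T k i ord0|.
apply: le_lt_trans (lebesgue_cbox_lty (- r) r); apply: le_measure; rewrite ?inE.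
- exact: open_measurable_cV.
- exact: measurable_cbox.
move=> x /subset_closure; have [_ _ _ <-] := hM => -[T _ Tx] i.
rewrite !mxE -ler_norml.
apply: le_trans (simplex_coord_le (cell_unitmx T) i Tx) _.
by rewrite (bigD1 T)//= lerDl; do 2 apply: sumr_ge0 => ? _.
Qed.

(** N is the union of all facet hyperplanes of all cells. Off N a point of a cell has positive
    barycentric coordinates, hence is interior. If it lies in T and K, conformity puts it in the
    hull of the common vertices; a vertex of T that K lacks would force a coordinate to be 0. So the
    vertex sets, and then the cells, coincide. *)
Lemma mesh_skeleton : exists N : set E, [/\ measurable N, leb N = 0%E,
  forall x, ~ N x -> forall T : 'I_(ncells M), cell T x -> (cell T)° x
  & forall x, ~ N x -> forall T K : 'I_(ncells M), cell T x -> cell K x -> T = K].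
Proof.
have [_ injc conf _] := hM.
pose N := \bigcup_(Tk in [set: 'I_(ncells M) * 'I_d.+1])
  [set x | bary (vertex Tk.1) Tk.2 x = 0].
have bneg (Tk : 'I_(ncells M) * 'I_d.+1) : leb.-negligible [set x | bary (vertex Tk.1) Tk.2 x = 0].
  exists [set x | bary (vertex Tk.1) Tk.2 x = 0]; split=> //.
    exact: measurable_bary0.
  exact: (lebesgue_bary0 (cell_unitmx Tk.1) Tk.2).
have mN : measurable N.
  by apply: fin_bigcup_measurable => [|Tk _]; [exact: finite_finset|exact: measurable_bary0].
exists N; split=> //.
- apply/negligibleP => //.
  have : {ae leb, forall x, forall Tk : 'I_(ncells M) * 'I_d.+1, bary (vertex Tk.1) Tk.2 x <> 0}.
    apply: (@filter_forall _ _ (fun Tk => [set x | bary (vertex Tk.1) Tk.2 x <> 0])).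
    move=> Tk; apply: negligibleS (bneg Tk) => x /=; exact: contrapT.
  by apply: negligibleS => x [Tk _ /= b0]; apply; exact: b0.
- move=> x Nx T Tx; apply: (open_simplex_interior (cell_unitmx T)).
  move=> k; rewrite lt_neqAle eq_sym; apply/andP; split.
    by apply/eqP => b0; apply: Nx; exists (T, k).
  by move: k; apply/(hull_bary (cell_unitmx T)).
have vsub x (T K : 'I_(ncells M)) : ~ N x -> cell T x -> cell K x ->
    range (vertex T) `<=` range (vertex K).
  move=> Nx Tx Kx y [k _ <-]; apply: contrapT => Kk; apply: Nx; exists (T, k) => //=.
  apply: (hull_face (cell_unitmx T) (S := range (vertex T) `&` range (vertex K))).
  - exact: subIsetl.
  - by move=> [].
  - by rewrite -conf.
move=> x Nx T K Tx Kx; apply: injc; rewrite /cell; congr hull.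
by apply/seteqP; split; exact: (vsub x).
Qed.

End mesh.

(** * The two bilinear forms on V_H *)

Section Rintegral_ae.
Context d (T : measurableType d) (R : realType) (mu : {measure set T -> \bar R}).

Lemma ae_Rintegral (D1 D2 : set T) (f g : T -> R) :
  {ae mu, forall x, (f \_ D1) x = (g \_ D2) x} ->
  \int[mu]_(x in D1) f x = \int[mu]_(x in D2) g x.
Proof.
move=> [N [mN N0 sN]]; apply: (Rintegral_null_set mN N0) => x Nx.
by apply: contrapT => h; exact/Nx/sN.
Qed.

Lemma ae_eq_Rintegral (D : set T) (f g : T -> R) :
  {ae mu, forall x, D x -> f x = g x} ->
  \int[mu]_(x in D) f x = \int[mu]_(x in D) g x.
Proof.
move=> fg; apply: ae_Rintegral; apply: filterS fg => x fgx.
by rewrite !patchE; case: ifPn => //; rewrite inE => /fgx.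
Qed.

Lemma integrable_sum_EFin (D : set T) (I : Type) (r : seq I) (f : I -> T -> R) :
  measurable D -> (forall i, mu.-integrable D (EFin \o f i)) ->
  mu.-integrable D (fun x => (\sum_(i <- r) f i x)%:E).
Proof.
move=> mD fi; under eq_fun do rewrite -sumEFin.
by apply: integrable_sum => // i _; exact: fi.
Qed.

Lemma Rintegral_sum (D : set T) (I : Type) (r : seq I) (f : I -> T -> R) :
  measurable D -> (forall i, mu.-integrable D (EFin \o f i)) ->
  \int[mu]_(x in D) (\sum_(i <- r) f i x) = \sum_(i <- r) \int[mu]_(x in D) f i x.
Proof.
move=> mD fi; elim: r => [|i r IHr].
  by under eq_Rintegral do rewrite big_nil; rewrite big_nil Rintegral_cst// mul0r.
under eq_Rintegral do rewrite big_cons; rewrite big_cons RintegralD// ?IHr//.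
exact: integrable_sum_EFin.
Qed.

End Rintegral_ae.

Section dot_mulmx.
Variables (R : realType) (d : nat).
Implicit Types (u v : 'cV[R]_d) (B : 'M[R]_d).

Lemma dot_mulmx u B v :
  dot u (B *m v) = \sum_i \sum_k B i k * (u i ord0 * v k ord0).
Proof.
apply: eq_bigr => i _; rewrite mxE mulr_sumr; apply: eq_bigr => k _.
by rewrite mulrCA.
Qed.

Lemma dot_mulmx_sym u B v : B^T = B -> dot u (B *m v) = dot v (B *m u).
Proof.
move=> BT; rewrite !dot_mulmx exchange_big/=; apply: eq_bigr => i _.
by apply: eq_bigr => k _; rewrite -[in LHS]BT mxE (mulrC (u _ _)).
Qed.

End dot_mulmx.

(** * Cellwise evaluation of the two forms *)

Section assembly.
Variables (R : realType) (d : nat).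
Notation E := 'cV[R]_d.
Notation leb := (lebesgue_cV R d).
Variables (Omega : set E) (A : E -> 'M[R]_d) (M : mesh R d).
Hypotheses (oOmega : open Omega) (lipOmega : lipschitz_boundary Omega).
Hypothesis hM : regular_triangulation Omega M.
Hypothesis LA : forall i j, in_Lp +oo%E Omega (fun x => A x i j).
Hypothesis symA : {ae leb, forall x, Omega x -> (A x)^T = A x}.
Notation V := (H10 Omega).
Notation grad := (grad Omega).
Notation "'cellI' T" := ((@cell _ _ M T)°) (at level 10).
Implicit Types T K : 'I_(ncells M).

Let mOmega : measurable Omega := open_measurable_cV oOmega.
Let Omegaoo : (leb Omega < +oo)%E := lebesgue_domain_lty hM oOmega.

Lemma H10_grad v : V v -> weak_gradient Omega v (grad v).
Proof. by move=> [[_ [g vg]] _]; exact: (@xgetPex _ _ [set g | weak_gradient Omega v g]) (ex_intro _ g vg). Qed.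

Lemma H10_Lp2 v : V v -> in_Lp 2%:E Omega v.
Proof. by move=> [[]]. Qed.

Lemma cellI_sub T : cellI T `<=` Omega.
Proof.
move=> x Tx; apply: lipschitz_interior_closure => //.
by apply: interiorS Tx; exact: cell_sub_closure.
Qed.

Lemma measurable_cellI T : measurable (cellI T).
Proof. by apply: open_measurable_cV; exact: open_interior. Qed.

Lemma integrable_cellI T (f : E -> \bar R) :
  leb.-integrable Omega f -> leb.-integrable (cellI T) f.
Proof.
by apply: integrableS => //; [exact: measurable_cellI|exact: cellI_sub].
Qed.

Lemma ae_cell : {ae leb, forall x,
  [/\ forall T, cell T x -> cellI T x,
      forall T K, cellI T x -> cellI K x -> T = K
    & Omega x -> exists T, cellI T x]}.
Proof.
have [N [mN N0 NI NU]] := mesh_skeleton hM.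
exists N; split=> // x; apply: contra_notP => Nx; split.
- exact: NI.
- by move=> T K /interior_subset Tx /interior_subset; exact: NU.
- move=> /subset_closure; have [_ _ _ <-] := hM => -[T _ Tx].
  by exists T; exact: NI.
Qed.

(* A closed cell may meet the boundary of Omega, where A and the gradients are
   arbitrary; its interior is contained in Omega. *)
Lemma Rintegral_cellI T (f : E -> R) :
  \int[leb]_(x in cell T) f x = \int[leb]_(x in cellI T) f x.
Proof.
apply: ae_Rintegral; apply: filterS ae_cell => x [cI _ _].
rewrite !patchE; case: (pselect (cell T x)) => Tx.
  by rewrite !mem_set//; exact: cI.
by rewrite !memNset// => /interior_subset.
Qed.

Lemma vol_cellI T : vol (cell T) = vol (cellI T).
Proof.
have := @Rintegral_cellI T (cst 1); rewrite !Rintegral_cst ?mul1r//.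
- exact: measurable_cellI.
- exact: measurable_cell hM _.
Qed.

(** On Omega, f is almost everywhere the sum of its restrictions to the open cells. *)
Lemma Rintegral_cells (f : E -> R) : leb.-integrable Omega (EFin \o f) ->
  \int[leb]_(x in Omega) f x = \sum_(T < ncells M) \int[leb]_(x in cell T) f x.
Proof.
move=> fi; transitivity (\int[leb]_(x in Omega) (\sum_(T < ncells M) (f \_ (cellI T)) x)).
  apply: ae_eq_Rintegral; apply: filterS ae_cell => x [_ cU cO] Ox.
  have [T Tx] := cO Ox; rewrite (bigD1 T)//= big1 ?addr0.
    by rewrite patchE mem_set.
  move=> K KT; rewrite patchE memNset// => Kx.
  by move: KT; rewrite (cU _ _ Tx Kx) eqxx.
rewrite Rintegral_sum//.
  apply: eq_bigr => T _; rewrite Rintegral_cellI -Rintegral_mkcondr.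
  by rewrite setIidr//; exact: cellI_sub.
move=> T; rewrite -[X in integrable _ _ X]restrict_EFin.
apply/integrable_restrict => //; first exact: measurable_cellI.
rewrite setIidr; last exact: cellI_sub.
exact: integrable_cellI.
Qed.

(** The integrand is exchanged almost everywhere for an integrable step function. Used for the inner
    and for the outer integral of [afrak]. *)
Lemma integral_cells_cst (f : E -> R) (c : 'I_(ncells M) -> R) :
  {ae leb, forall x, forall T, cellI T x -> f x = c T} ->
  \int[leb]_(x in Omega) f x = \sum_(T < ncells M) vol (cell T) * c T.
Proof.
move=> fc; transitivity (\int[leb]_(x in Omega) (\sum_(T < ncells M) c T * \1_(cellI T) x)).
  apply: ae_eq_Rintegral; apply: filterS2 ae_cell fc => x [_ cU cO] fcx Ox.
  have [T Tx] := cO Ox; rewrite (fcx _ Tx) (bigD1 T)//= big1 ?addr0.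
    by rewrite indicE mem_set// mulr1.
  move=> K KT; rewrite indicE memNset ?mulr0// => Kx.
  by move: KT; rewrite (cU _ _ Tx Kx) eqxx.
have i1 T : leb.-integrable Omega (EFin \o (\1_(cellI T) : E -> R)).
  apply: measurable_bounded_integrable => //.
    by apply: measurable_indic; exact: measurable_cellI.
  exists 1; split; first exact: num_real.
  by move=> N N1 x _ /=; rewrite indicE normr_nat (le_trans _ (ltW N1))// lern1 leq_b1.
rewrite Rintegral_sum//; last first.
  by move=> T; apply: integrable_EFinZl => //; exact: i1.
apply: eq_bigr => T _; rewrite RintegralZl// mulrC; congr (_ * _).
rewrite vol_cellI /Rintegral integral_indic//; last exact: measurable_cellI.
by rewrite setIidl//; exact: cellI_sub.
Qed.

Lemma VH_cell_affine v T : VH Omega M v -> affine_on (cell T) v (cell_grad v T).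
Proof.
move=> [_ _ /(_ T) [b vb]].
exact: (@xgetPex _ _ [set b | affine_on (cell T) v b]) (ex_intro _ b vb).
Qed.

Lemma VH_grad v : VH Omega M v ->
  {ae leb, forall x, forall T, cellI T x -> grad v x = cell_grad v T}.
Proof.
move=> vVH; have [Vv _ _] := vVH.
apply: (@filter_forall _ _
  (fun T => [set x | cellI T x -> grad v x = cell_grad v T])) => T.
apply: (weak_gradient_affine oOmega Omegaoo) (H10_grad Vv) _.
- exact: open_interior.
- exact: cellI_sub.
have [c vE] := VH_cell_affine T vVH.
by exists c => x /interior_subset; exact: vE.
Qed.

(** Expanded in entries, each term is a bounded coefficient times a product of two square-integrable
    functions. *)
Lemma integrable_form (g h : E -> E) :
  (forall j, in_Lp 2%:E Omega (fun x => g x j ord0)) ->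
  (forall j, in_Lp 2%:E Omega (fun x => h x j ord0)) ->
  leb.-integrable Omega (fun x => (dot (g x) (A x *m h x))%:E).
Proof.
move=> Lg Lh; under eq_fun do rewrite dot_mulmx.
apply: integrable_sum_EFin => // i; apply: integrable_sum_EFin => // k.
by apply: in_Lpoo_mul_integrable => //; exact: in_Lp2_mul_integrable.
Qed.

Lemma integrable_mulmx (h : E -> E) i :
  (forall j, in_Lp 2%:E Omega (fun x => h x j ord0)) ->
  leb.-integrable Omega (fun x => ((A x *m h x) i ord0)%:E).
Proof.
move=> Lh; under eq_fun do rewrite mxE.
apply: integrable_sum_EFin => // k.
by apply: in_Lpoo_mul_integrable => //; exact: in_Lp2_integrable.
Qed.

Lemma aform_cells u w : VH Omega M u -> V w ->
  aform Omega A u w =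
  \sum_(K < ncells M) dot (cell_grad u K) (vint (cell K) (fun x => A x *m grad w x)).
Proof.
move=> uVH Vw; have [Vu _ _] := uVH.
have [Lu _] := H10_grad Vu; have [Lw _] := H10_grad Vw.
transitivity (\int[leb]_(x in Omega) dot (grad u x) (A x *m grad w x)).
  apply: ae_eq_Rintegral; apply: filterS symA => x sx Ox.
  by rewrite dot_mulmx_sym// sx.
rewrite Rintegral_cells; last exact: integrable_form.
apply: eq_bigr => K _; rewrite Rintegral_cellI.
transitivity (\int[leb]_(x in cellI K)
    (\sum_i cell_grad u K i ord0 * (A x *m grad w x) i ord0)).
  apply: ae_eq_Rintegral; apply: filterS (VH_grad uVH) => x ux Kx.
  by rewrite (ux K).
have iAw i : leb.-integrable (cellI K) (fun x => ((A x *m grad w x) i ord0)%:E).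
  by apply: integrable_cellI; exact: integrable_mulmx.
rewrite Rintegral_sum; [|exact: measurable_cellI|]; last first.
  by move=> i; exact: (integrable_EFinZl _ (measurable_cellI K) (iAw i)).
apply: eq_bigr => i _; rewrite RintegralZl; [|exact: measurable_cellI|exact: iAw].
by rewrite mxE Rintegral_cellI.
Qed.

(** Brings a(u, v) to the shape of the diagonal part of the kernel, which contains the integral of A
    over the cell. *)
Lemma vint_VH v K : VH Omega M v ->
  vint (cell K) (fun x => A x *m grad v x) = mint (cell K) A *m cell_grad v K.
Proof.
move=> vVH; apply/colP => i; rewrite !mxE Rintegral_cellI.
have iA k : leb.-integrable (cellI K) (fun x => (A x i k)%:E).
  apply: integrable_cellI; under eq_fun do rewrite -[A _ _ _]mulr1.
  apply: in_Lpoo_mul_integrable => //.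
  apply: (@measurable_bounded_integrable _ _ _ leb (cst 1)) => //.
  exact: bounded_cst.
transitivity (\int[leb]_(x in cellI K)
    (\sum_k cell_grad v K k ord0 * A x i k)).
  apply: ae_eq_Rintegral; apply: filterS (VH_grad vVH) => x vx Kx.
  by rewrite (vx K)// mxE; apply: eq_bigr => k _; rewrite mulrC.
rewrite Rintegral_sum; [|exact: measurable_cellI|]; last first.
  by move=> k; exact: (integrable_EFinZl _ (measurable_cellI K) (iA k)).
apply: eq_bigr => k _; rewrite RintegralZl; [|exact: measurable_cellI|exact: iA].
by rewrite mxE Rintegral_cellI mulrC.
Qed.

Variable q : 'I_(ncells M) -> 'I_d -> E -> R.
Hypothesis Vq : forall T j, V (q T j).

(** [grad] is a choice and not linear on the nose. The linear combination of the chosen gradients is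
    a weak gradient of v - Cv, so one exists and the chosen one is valid; uniqueness equates the two
    almost everywhere. *)
Lemma aform_corrector u v : VH Omega M u -> V v ->
  aform Omega A u (v \- corrector q v) = aform Omega A u v -
    \sum_(T < ncells M) \sum_(j < d) cell_grad v T j ord0 * aform Omega A u (q T j).
Proof.
move=> [Vu _ _] Vv.
(* The double sum over cells and directions is flattened to one sum over pairs. *)
pose c (Tj : 'I_(ncells M) * 'I_d) := cell_grad v Tj.1 Tj.2 ord0.
have [LC gC] := @weak_gradient_sum _ _ _ oOmega Omegaoo _ (index_enum _) c
  (fun Tj => q Tj.1 Tj.2) (fun Tj => grad (q Tj.1 Tj.2))
  (fun Tj => H10_Lp2 (Vq _ _)) (fun Tj => H10_grad (Vq _ _)).
have gw := weak_gradient_lin oOmega Omegaoo (-1) LC (H10_Lp2 Vv) gC (H10_grad Vv).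
have wE : v \- corrector q v =
    (fun x => -1 * (\sum_Tj c Tj * q Tj.1 Tj.2 x) + v x).
  apply/funext => x; rewrite /= mulN1r addrC; congr (- _ + _).
  by rewrite /corrector pair_big.
rewrite -wE in gw.
have gw' : weak_gradient Omega (v \- corrector q v) (grad (v \- corrector q v)).
  exact: (@xgetPex _ _ [set g | weak_gradient Omega _ g]) (ex_intro _ _ gw).
have gE := weak_gradient_unique oOmega Omegaoo gw' gw.
have [Lu _] := H10_grad Vu; have [Lv _] := H10_grad Vv.
have iform w : V w ->
    leb.-integrable Omega (fun x => (dot (grad w x) (A x *m grad u x))%:E).
  by move=> /H10_grad[Lw _]; exact: integrable_form.
transitivity (\int[leb]_(x in Omega)
   (dot (grad v x) (A x *m grad u x) - \sum_Tj c Tj *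
      dot (grad (q Tj.1 Tj.2) x) (A x *m grad u x))).
  apply: ae_eq_Rintegral; apply: filterS gE => x gx Ox; rewrite gx//.
  rewrite dotC dotDr dotZr mulN1r addrC dotC; congr (_ - _).
  by rewrite dotC dot_suml; apply: eq_bigr => Tj _; rewrite dotC dotZr dotC.
rewrite RintegralB//; last 2 first.
- exact: (iform _ Vv).
- apply: integrable_sum_EFin mOmega _ => Tj.
  exact: (integrable_EFinZl (c Tj) mOmega (iform _ (Vq Tj.1 Tj.2))).
congr (_ - _); rewrite Rintegral_sum//; last first.
  by move=> Tj; exact: (integrable_EFinZl (c Tj) mOmega (iform _ (Vq Tj.1 Tj.2))).
rewrite pair_big/=; apply: eq_bigr => -[T j] _ /=.
exact: (RintegralZl (c (T, j)) mOmega (iform _ (Vq T j))).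
Qed.

Lemma AH_cellI x y T K : (forall T K, cellI T x -> cellI K x -> T = K) ->
  (forall T K, cellI T y -> cellI K y -> T = K) ->
  cellI T x -> cellI K y -> AH Omega A q x y = AHmat Omega A q T K.
Proof.
move=> xU yU Tx Ky; rewrite /AH (bigD1 T)//= [X in _ + X]big1 ?addr0; last first.
  move=> T' T'T; rewrite big1// => K' _; rewrite indicE memNset.
    by rewrite mul0r scale0r.
  by move=> T'x; move: T'T; rewrite (xU _ _ Tx T'x) eqxx.
rewrite (bigD1 K)//= [X in _ + X]big1 ?addr0; last first.
  move=> K' K'K; rewrite [X in _ * X]indicE memNset; first by rewrite mulr0 scale0r.
  by move=> K'y; move: K'K; rewrite (yU _ _ Ky K'y) eqxx.
by rewrite !indicE !mem_set// mulr1 scale1r.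
Qed.

Lemma afrak_cells u v : VH Omega M u -> VH Omega M v ->
  afrak Omega A q u v = \sum_(T < ncells M) vol (cell T) * \sum_(K < ncells M) vol (cell K) *
    dot (cell_grad u K) (AHmat Omega A q T K *m cell_grad v T).
Proof.
move=> uVH vVH; apply: integral_cells_cst.
apply: filterS2 ae_cell (VH_grad vVH) => x [_ xU _] vx T Tx.
rewrite (vx _ Tx); apply: integral_cells_cst.
apply: filterS2 ae_cell (VH_grad uVH) => y [_ yU _] uy K Ky.
by rewrite (uy _ Ky) (AH_cellI xU yU Tx Ky).
Qed.

Lemma vol_AHmat T K (g h : E) :
  vol (cell T) * (vol (cell K) * dot g (AHmat Omega A q T K *m h)) =
  (T == K)%:R * dot g (mint (cell T) A *m h) -
  \sum_j h j ord0 * dot g (vint (cell K) (fun x => A x *m grad (q T j) x)).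
Proof.
have T0 : vol (cell T) != 0 by rewrite gt_eqF// (cell_vol_gt0 hM).
have K0 : vol (cell K) != 0 by rewrite gt_eqF// (cell_vol_gt0 hM).
set S := \sum_j _; set X := dot g (mint _ _ *m h).
(* Column k of [Kmat] comes from [q T k] and meets h_k, which will be the k-th component of the
   gradient of v on the source cell T. *)
have KS : dot g (Kmat Omega A q T K *m h) = (vol (cell T) * vol (cell K))^-1 * S.
  rewrite dot_mulmx exchange_big/= mulr_sumr; apply: eq_bigr => k _.
  rewrite /dot !mulr_sumr; apply: eq_bigr => i _.
  by rewrite mxE -/(dot _ _) [dot (unitv R i) _]dotC dot_unitv; ring.
rewrite /AHmat mulmxBl -!scalemxAl dotDr !dotZr [dot g (- _)]dotC dotNl
  [dot _ g]dotC KS -/X.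
by field; rewrite T0 K0.
Qed.

(** The Kronecker symbol retains K = T and yields a(u, v); the [Kmat] part yields the corrector
    terms once the sums over K and over directions are interchanged. *)
Lemma aform_afrak u v : VH Omega M u -> VH Omega M v ->
  aform Omega A u (v \- corrector q v) = afrak Omega A q u v.
Proof.
move=> uVH vVH; have [Vv _ _] := vVH.
rewrite (aform_corrector uVH Vv) (afrak_cells uVH vVH) (aform_cells uVH Vv).
under [in RHS]eq_bigr do rewrite mulr_sumr.
under [in RHS]eq_bigr do under eq_bigr do rewrite vol_AHmat.
under [in RHS]eq_bigr do rewrite sumrB.
rewrite sumrB; congr (_ - _).
  apply: eq_bigr => T _; rewrite (bigD1 T)//= eqxx mul1r big1 ?addr0 ?vint_VH//.
  by move=> K KT; rewrite eq_sym (negbTE KT) mul0r.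
apply: eq_bigr => T _; rewrite exchange_big/=; apply: eq_bigr => j _.
by rewrite (aform_cells uVH (Vq T j)) mulr_sumr.
Qed.

End assembly.

Theorem proposition2 (R : realType) (d : nat) (hd : (1 <= d <= 3)%N)
  (Omega : set 'cV[R]_d)
  (hOmega : open_polytope Omega) (hLip : lipschitz_boundary Omega)
  (alpha beta : R) (halpha : 0 < alpha) (hbeta : alpha <= beta)
  (A : 'cV[R]_d -> 'M[R]_d) (hA : elliptic_coefficient Omega A alpha beta)
  (M : mesh R d) (hM : regular_triangulation Omega M)
  (rho : R) (hrho : 0 < rho) (hqu : quasi_uniform rho M)
  (IH : ('cV[R]_d -> R) -> 'cV[R]_d -> R) (CIH : R)
  (hIH : quasi_interpolation Omega M IH CIH)
  (l : option nat)
  (q : 'I_(ncells M) -> 'I_d -> 'cV[R]_d -> R)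
  (hq : element_correctors Omega A IH l q)
  (f : 'cV[R]_d -> R) (hf : in_Lp 2%:E Omega f)
  (uH : 'cV[R]_d -> R) (huH : VH Omega M uH) :
  (forall vH, VH Omega M vH ->
     aform Omega A uH (vH \- corrector q vH) = load Omega f vH) <->
  (forall vH, VH Omega M vH ->
     afrak Omega A q uH vH = load Omega f vH).
Proof.
have [oOmega _] := hOmega; have [LA symA _] := hA.
have Vq T j : H10 Omega (q T j) by have [[[]]] := hq T j.
(* The left sides agree for each test function, so both conditions are the same equations. *)
by split=> h vH hvH; rewrite -(h vH hvH); [apply: esym|];
  exact: (aform_afrak oOmega hLip hM LA symA Vq huH hvH).
Qed.
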